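(* Consider the lists $L(1,\dots,8)$ realized by generic configurations of eight points in convex position in $\mathbb{R}P^2$. (i) Any list $L(1,\dots,8)$ is determined by the octuple of distances $(1\to2,\,2\to3,\,\dots,\,7\to 8,\,8\to1)$. (ii) Each orbit of lists under the action of $D_8$ is determined by an octuple of integers (ranging between $-6$ and $+6$), defined up to cyclic permutation, and reversion with change of all signs. (iii) Let $\sigma=(1\to2)+(2\to3)+\dots+(8\to1)$. The absolute value $|\sigma|$ is an invariant of the orbits, that takes all of the even values between $0$ and $8$. The numbers of orbits realizing $|\sigma|=0,2,4,6,8$ are respectively $14,12,16,4$ and $1$.
   Context: Convex position: eight points of $\mathbb{R}P^2$ lie in convex position if there is a line $L_0\subset\mathbb{R}P^2$ such that, in the affine plane $\mathbb{R}P^2\setminus L_0$, they are the vertices of a strictly convex octagon. The labels are always chosen so that $1,2,\dots,8$ is the cyclic order of the vertices along the octagon. Lists: any five of the points lie on a unique conic, which is non-degenerate; its inside is the component of its complement in $\mathbb{R}P^2$ homeomorphic to a disc, and its outside is the other component. The configuration is generic if no six of the points lie on a conic. The list $L(1,\dots,8)$ is the following information: for each of the $56$ conics through five of the points, and for each of the three remaining points, whether that point lies inside or outside of the conic. $D_8$ is the dihedral group of order $16$ of symmetries of the octagon with consecutive vertices $1,\dots,8$; it acts on lists by relabelling the points. Distance: let $A,B$ be two consecutive points in the cyclic order $1,\dots,8$, and let $C,D,E,F,G,H$ be the six other points. The distance $A\to B$ is the number of conics passing through five points among $C,D,E,F,G,H$ that separate $A$ from $B$ (one of $A,B$ inside,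 the other outside), multiplied by $-1$ if $A$ is the outermost of the two points (that is, if $A$ lies outside and $B$ inside of the separating conics). It depends only on the list.
   Formalization: Part (i) is false as stated: for octuples equivalent to (3,0,0,0,-3,0,0,0) or (1,0,-1,1,-1,0,1,-1), two lists swapped by a reflection in D_8 share the octuple; the formal (i) says the octuple determines the list except that, for these two classes, the list may be replaced by such a mirror image. *)

(* Defs.v *)
From HB Require Import structures.
From mathcomp Require Import all_boot all_order all_algebra all_fingroup.
From mathcomp Require Import all_classical all_reals topology.
From mathcomp Require Import generic_quotient.

Set Implicit Arguments.
Unset Strict Implicit.
Unset Printing Implicit Defensive.

Import Order.TTheory GRing.Theory Num.Theory numFieldTopology.Exports.
Local Open Scope classical_set_scope.
Local Open Scope quotient_scope.
Local Open Scope ring_scope.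

Section ProjectivePlane.
Variable R : realType.

Definition nonzero_vec : topologicalType :=
  set_type [set v : 'rV[R]_3 | v != 0].

(* Row spaces are compared, so proportional vectors are identified. *)
Definition same_line (v w : nonzero_vec) : bool := (val v == val w)%MS.

Lemma same_line_refl : reflexive same_line.
Proof. by move=> v; rewrite /same_line submx_refl. Qed.

Lemma same_line_sym : symmetric same_line.
Proof. by move=> v w; rewrite /same_line andbC. Qed.

Lemma same_line_trans : transitive same_line.
Proof. by move=> v u w /eqmxP uv /eqmxP vw; apply/eqmxP/(eqmx_trans uv). Qed.

Canonical same_line_equiv :=
  EquivRel same_line same_line_refl same_line_sym same_line_trans.

Definition RP2 : topologicalType := quotient_topology {eq_quot same_line}.

(* Homogeneous coordinates, chosen once and for all for each point. *)
Definition hcoord (p : RP2) : 'rV[R]_3 := val (repr p).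

Definition is_conic (C : set RP2) : Prop :=
  exists S : 'M[R]_3, [/\ S^T = S, S != 0 &
    C = [set p | (hcoord p *m S *m (hcoord p)^T) 0 0 = 0]].

Definition homeomorphic (T U : topologicalType) (A : set T) (B : set U) :=
  exists (f : A -> B) (g : B -> A),
    [/\ continuous f, continuous g, cancel f g & cancel g f].

Definition disc : set (R * R)%type := [set z | z.1 ^+ 2 + z.2 ^+ 2 < 1].

Definition inside (C : set RP2) : set RP2 :=
  [set p | ~ C p /\ homeomorphic (connected_component (~` C) p) disc].

(* The point of the affine plane {v | v *m l = 1} representing p, when p is not
   on the line of equation l. *)
Definition affine_pt (l : 'cV[R]_3) (p : RP2) : 'rV[R]_3 :=
  ((hcoord p *m l) 0 0)^-1 *: hcoord p.

Definition orient (a b c : 'rV[R]_3) : R :=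
  \det (\matrix_(m < 3) nth 0 [:: a; b; c] m).

(* c and d are strictly on the same side of the affine line ab. *)
Definition same_side (a b c d : 'rV[R]_3) : bool :=
  0 < orient a b c * orient a b d.

(* Labels live in 'I_8 = Z/8, so that i + 1 is the cyclic successor of i.
   An octagon is strictly convex when the line through each side leaves the six
   other vertices strictly on one side; this also makes 0, ..., 7 the cyclic
   order of the vertices. *)
Definition strictly_convex_octagon (a : 'I_8 -> 'rV[R]_3) : Prop :=
  forall i j k : 'I_8, j \notin [:: i; i + 1] -> k \notin [:: i; i + 1] ->
    same_side (a i) (a (i + 1)) (a j) (a k).

Definition convex_position (x : 'I_8 -> RP2) : Prop :=
  exists2 l : 'cV[R]_3, l != 0 &
    (forall i, (hcoord (x i) *m l) 0 0 != 0) /\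
    strictly_convex_octagon (affine_pt l \o x).

Definition conic_through (x : 'I_8 -> RP2) (K : {set 'I_8}) (C : set RP2) :=
  is_conic C /\ forall k, k \in K -> C (x k).

Definition generic (x : 'I_8 -> RP2) : Prop :=
  forall K : {set 'I_8}, #|K| = 6%N -> ~ exists C, conic_through x K C.

End ProjectivePlane.

(* A list maps (K, i), where K consists of five labels and i is not in K, to
   true if the point i lies inside the conic through the points of K, and to
   false if it lies outside; other pairs carry no information and are mapped to
   false. *)
Notation eight_list := {ffun {set 'I_8} * 'I_8 -> bool}.

Definition list_of (R : realType) (x : 'I_8 -> RP2 R) : eight_list :=
  [ffun Ki : {set 'I_8} * 'I_8 => [&& #|Ki.1| == 5%N, Ki.2 \notin Ki.1 &
     `[< exists2 C, conic_through x Ki.1 C & inside C (x Ki.2) >]]].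

Definition realized_lists (R : realType) : {set eight_list} :=
  [set L | `[< exists x : 'I_8 -> RP2 R,
                 [/\ convex_position x, generic x & L = list_of x] >]]%SET.

Definition relabel (L : eight_list) (s : {perm 'I_8}) : eight_list :=
  [ffun Ki : {set 'I_8} * 'I_8 => L ((s @^-1: Ki.1)%SET, (s^-1)%g Ki.2)].

Lemma relabel1 : relabel^~ 1%g =1 id.
Proof.
move=> L; apply/ffunP => -[K i]; rewrite ffunE /= invg1 perm1.
by congr (L (_, _)); apply/setP => j; rewrite inE perm1.
Qed.

Lemma relabelM L : act_morph relabel L.
Proof.
move=> s t; apply/ffunP => -[K i]; rewrite !ffunE /= invMg permM.
by congr (L (_, _)); apply/setP => j; rewrite !inE permM.
Qed.

Definition relabel_action := TotalAction relabel1 relabelM.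

Definition rotation (k : 'I_8) : {perm 'I_8} := perm (@addIr _ k).
Definition reflection (k : 'I_8) : {perm 'I_8} := perm (@subrI _ k).

Definition D8 : {set {perm 'I_8}} :=
  [set s | [exists k, (s == rotation k) || (s == reflection k)]]%SET.

Definition list_orbit (L : eight_list) : {set eight_list} :=
  orbit relabel_action D8 L.

Definition separating (L : eight_list) (A B : 'I_8) : {set {set 'I_8}} :=
  [set K : {set 'I_8} | [&& #|K| == 5%N, A \notin K, B \notin K &
     L (K, A) != L (K, B)]]%SET.

(* A lies outside and B inside of the conics that separate A from B. *)
Definition outermost (L : eight_list) (A B : 'I_8) : bool :=
  [forall K in separating L A B, ~~ L (K, A) && L (K, B)].

Definition distance (L : eight_list) (A B : 'I_8) : int :=
  if outermost L A B then - #|separating L A B|%:Z else #|separating L A B|%:Z.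

Definition octuple (L : eight_list) : {ffun 'I_8 -> int} :=
  [ffun i => distance L i (i + 1)].

(* Equality up to cyclic permutation, and reversion with change of all signs. *)
Definition octuple_equiv (t u : {ffun 'I_8 -> int}) : Prop :=
  exists k : 'I_8,
    (forall i, u i = t (i + k)) \/ (forall i, u i = - t (k - i)).

Definition octuple_of_seq (s : seq int) : {ffun 'I_8 -> int} :=
  [ffun i => s`_(nat_of_ord i)].

(* Each of these octuples is turned into a cyclic permutation of itself by
   reversion with change of all signs, whereas no reflection in D8 fixes a
   realized list: a list with such an octuple and its image under the
   corresponding reflection are distinct lists with the same octuple. *)
Definition ambiguous_octuple (t : {ffun 'I_8 -> int}) : Prop :=
  octuple_equiv t (octuple_of_seq [:: 3; 0; 0; 0; -3; 0; 0; 0]) \/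
  octuple_equiv t (octuple_of_seq [:: 1; 0; -1; 1; -1; 0; 1; -1]).

Definition sigma (L : eight_list) : int := \sum_i octuple L i.

Definition orbits_with (R : realType) (m : nat) : {set {set eight_list}} :=
  [set list_orbit L | L in realized_lists R & `|sigma L|%N == m]%SET.

(* Main.v *)
From Stdlib Require Import ZArith.
Require Import Defs.
From mathcomp Require Import all_boot all_order all_algebra all_fingroup.
From mathcomp Require Import all_classical all_reals topology normedtype.
From mathcomp Require Import generic_quotient.
From mathcomp Require Import ring lra ssrZ zify.

(** The list of a configuration is a sign vector, and only 752 sign vectors occur.

A point p off a nondegenerate conic with real points, of equation q and matrix S, is inside
exactly when q(p) det S > 0 ([insideP]).  For this sign the component of p is a disc in
suitable projective coordinates.  For the other sign it contains a projective line, along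
which a direction vector comes back reversed, and no disc contains such a loop
([one_sided_not_disc]).  The conic through a, b, c, d, e has the equation
[hexad a b c d e v = 0], where [hexad] is the bracket polynomial that detects six points on a
conic, and the determinant of its matrix is a negative multiple of the product of the ten
brackets of the five points ([conic5_unique]).  In convex position all brackets of labels
i < j < k can be made positive ([convex_position_frame]).  So the list amounts to the signs
of the hexads of the 28 sets of six labels: this is the code of the configuration
([list_of_decode]).

Few codes can occur.  Fix four labels and let (x, y) be the values at a fifth one of two
degenerate conics that span the pencil through the four.  The hexad of the four labels and
two others is the determinant of two such vectors.  The Pluecker relation between four
plane vectors is a three-term relation between products of hexads ([hexad_gp]).  A second
relation ([hexad_pencil]) expresses a linear dependence of three hexads, whose coefficients
are values of a line pair; convexity gives their signs.  In a vanishing sum of three nonzero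
terms the signs are not all equal, and the codes that satisfy all these conditions are
found by an exhaustive search: there are 752 ([code_in_codes]).

All of them occur.  The 47 octagons [configurations], with integer coordinates between -9
and 9, and their images under rotations and reflections of the labels realize every code
([codes_realized]).

The octuple and the relabellings can be read off the code, so that the bounds on the
distances, the action of D8 on octuples, the list of pairs of codes with the same octuple
and the number of orbits are finite computations.  Equivalent octuples give the same orbit
because some element of D8 carries one list to a list with the octuple of the other, and
lists with the same octuple differ at most by a reflection. *)

Set Implicit Arguments.
Unset Strict Implicit.
Unset Printing Implicit Defensive.

Import Order.TTheory GRing.Theory Num.Theory.
Local Open Scope ring_scope.

(** * Brackets and the six-point form *)

(** Vectors are triples here, so that brackets of integer points can be evaluated. *)
Definition bracket (T : pzRingType) (u v w : T * T * T) : T :=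
  let: (u0, u1, u2) := u in let: (v0, v1, v2) := v in let: (w0, w1, w2) := w in
  u0 * (v1 * w2 - v2 * w1) - u1 * (v0 * w2 - v2 * w0) + u2 * (v0 * w1 - v1 * w0).

(** The first four points span a pencil of conics, which contains the line pairs ab.cd and
    ac.bd; the hexad is the determinant of their values at the last two points.  So it
    vanishes when a conic of the pencil passes through both e and f. *)
Definition hexad (T : pzRingType) (a b c d e f : T * T * T) : T :=
  bracket a b e * bracket c d e * (bracket a c f * bracket b d f) -
  bracket a b f * bracket c d f * (bracket a c e * bracket b d e).

Definition bracket_at (T : pzRingType) (p : nat -> T * T * T) (w : seq nat) : T :=
  let i := nth 0%N w in bracket (p (i 0%N)) (p (i 1%N)) (p (i 2%N)).

Definition hexad_at (T : pzRingType) (p : nat -> T * T * T) (w : seq nat) : T :=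
  let i := nth 0%N w in
  hexad (p (i 0%N)) (p (i 1%N)) (p (i 2%N)) (p (i 3%N)) (p (i 4%N)) (p (i 5%N)).

Section BracketAlgebra.
Variable T : comPzRingType.
Implicit Types a b c d e f : T * T * T.

Lemma bracketC12 a b c : bracket b a c = - bracket a b c.
Proof. by case: a b c => [[? ?] ?] [[? ?] ?] [[? ?] ?] /=; ring. Qed.

Lemma bracketC23 a b c : bracket a c b = - bracket a b c.
Proof. by case: a b c => [[? ?] ?] [[? ?] ?] [[? ?] ?] /=; ring. Qed.

Lemma bracket_cycle a b c : bracket b c a = bracket a b c.
Proof. by case: a b c => [[? ?] ?] [[? ?] ?] [[? ?] ?] /=; ring. Qed.

(** The pivot of this three-term relation is e.  The variants below differ by the place of
    the pivot, which keeps the brackets free of signs where they are used. *)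
Lemma plucker a b c d e :
  bracket a b e * bracket c d e - bracket a c e * bracket b d e +
  bracket a d e * bracket b c e = 0.
Proof.
by case: a b c d e => [[? ?] ?] [[? ?] ?] [[? ?] ?] [[? ?] ?] [[? ?] ?] /=; ring.
Qed.

Lemma hexadC12 a b c d e f : hexad b a c d e f = - hexad a b c d e f.
Proof.
apply/eqP; rewrite -subr_eq0 opprK; apply/eqP.
rewrite /hexad !(bracketC12 a b).
transitivity (bracket a b f * bracket c d f *
    (bracket a b e * bracket c d e - bracket a c e * bracket b d e +
     bracket a d e * bracket b c e) -
  bracket a b e * bracket c d e *
    (bracket a b f * bracket c d f - bracket a c f * bracket b d f +
     bracket a d f * bracket b c f)); first by ring.
by rewrite !plucker !mulr0 subr0.
Qed.

Lemma hexadC23 a b c d e f : hexad a c b d e f = - hexad a b c d e f.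
Proof. by rewrite /hexad; ring. Qed.

Lemma hexadC34 a b c d e f : hexad a b d c e f = - hexad a b c d e f.
Proof.
apply/eqP; rewrite -subr_eq0 opprK; apply/eqP.
rewrite /hexad !(bracketC12 c d).
transitivity (bracket a b f * bracket c d f *
    (bracket a b e * bracket c d e - bracket a c e * bracket b d e +
     bracket a d e * bracket b c e) -
  bracket a b e * bracket c d e *
    (bracket a b f * bracket c d f - bracket a c f * bracket b d f +
     bracket a d f * bracket b c f)); first by ring.
by rewrite !plucker !mulr0 subr0.
Qed.

Lemma plucker_mid a b d e f :
  bracket a b d * bracket b e f - bracket a b e * bracket b d f +
  bracket a b f * bracket b d e = 0.
Proof.
by case: a b d e f => [[? ?] ?] [[? ?] ?] [[? ?] ?] [[? ?] ?] [[? ?] ?] /=; ring.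
Qed.

Lemma plucker_fst a b c d e :
  bracket a b c * bracket a d e - bracket a b d * bracket a c e +
  bracket a b e * bracket a c d = 0.
Proof.
by case: a b c d e => [[? ?] ?] [[? ?] ?] [[? ?] ?] [[? ?] ?] [[? ?] ?] /=; ring.
Qed.

Lemma plucker_third a b c d e :
  bracket a b c * bracket c d e - bracket a c d * bracket b c e +
  bracket a c e * bracket b c d = 0.
Proof.
by case: a b c d e => [[? ?] ?] [[? ?] ?] [[? ?] ?] [[? ?] ?] [[? ?] ?] /=; ring.
Qed.

(** The exchange of a base point of the pencil with one of the two other points: the
    formula of the hexad hides it, and it follows from the relations with pivots b and c. *)
Lemma hexadC45 a b c d e f : hexad a b c e d f = - hexad a b c d e f.
Proof.
apply/eqP; rewrite -subr_eq0 opprK; apply/eqP.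
rewrite /hexad !(bracketC23 _ d e).
transitivity (bracket a b f * bracket b d e *
    (bracket a c d * bracket c e f - bracket a c e * bracket c d f +
     bracket a c f * bracket c d e) -
  bracket a c f * bracket c d e *
    (bracket a b d * bracket b e f - bracket a b e * bracket b d f +
     bracket a b f * bracket b d e)); first by ring.
by rewrite !plucker_mid !mulr0 subr0.
Qed.

Lemma hexadC56 a b c d e f : hexad a b c d f e = - hexad a b c d e f.
Proof. by rewrite /hexad; ring. Qed.

Lemma bracket0 a b :
  (bracket a a b = 0) * (bracket a b a = 0) * (bracket b a a = 0).
Proof. by case: a b => [[? ?] ?] [[? ?] ?] /=; split; first split; ring. Qed.

Lemma hexad_repeat a b c d e :
  [/\ hexad a b c d e a = 0, hexad a b c d e b = 0, hexad a b c d e c = 0,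
      hexad a b c d e d = 0 & hexad a b c d e e = 0].
Proof. by split; rewrite /hexad ?bracket0; ring. Qed.

(** Over fixed base points the hexads are the 2x2 determinants of plane vectors, the values
    of the two line pairs; this is the Pluecker relation between four of these vectors. *)
Lemma hexad_gp a b c d i j k l :
  hexad a b c d i j * hexad a b c d k l - hexad a b c d i k * hexad a b c d j l +
  hexad a b c d i l * hexad a b c d j k = 0.
Proof. by rewrite /hexad; ring. Qed.

(** The expansion of a 3x3 determinant with two equal rows, the values of ab.cd at f, g, h. *)
Lemma hexad_pencil a b c d f g h :
  bracket a b f * bracket c d f * hexad a b c d g h -
  bracket a b g * bracket c d g * hexad a b c d f h +
  bracket a b h * bracket c d h * hexad a b c d f g = 0.
Proof. by rewrite /hexad; ring. Qed.
End BracketAlgebra.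

Lemma bracket_rmorph (T U : comPzRingType) (h : {rmorphism T -> U}) u v w :
  let m (t : T * T * T) := (h t.1.1, h t.1.2, h t.2) in
  bracket (m u) (m v) (m w) = h (bracket u v w).
Proof.
by case: u v w => [[? ?] ?] [[? ?] ?] [[? ?] ?] /=; rewrite !(rmorphB, rmorphD, rmorphM).
Qed.

(** * Conics through five points *)

Lemma det_mx22 (T : comNzRingType) (M : 'M[T]_2) : \det M = M 0 0 * M 1 1 - M 0 1 * M 1 0.
Proof.
rewrite (expand_det_row _ 0) !big_ord_recl big_ord0 addr0 /cofactor !det_mx11 !mxE /=.
rewrite expr0 expr1 mul1r mulN1r mulrN.
by congr (_ * M _ _ - M _ _ * M _ _); apply/val_inj.
Qed.
Lemma det_mx33 (T : comNzRingType) (M : 'M[T]_3) : \det M =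
  bracket (M 0 0, M 0 1, M 0 2%:R) (M 1 0, M 1 1, M 1 2%:R) (M 2%:R 0, M 2%:R 1, M 2%:R 2%:R).
Proof.
rewrite (expand_det_row _ 0) !big_ord_recl big_ord0 addr0 /cofactor !det_mx22 !mxE /=.
rewrite expr0 expr1 mul1r mulN1r (_ : (-1) ^+ _ = 1) ?mul1r; last by rewrite expr2 mulN1r opprK.
rewrite mulrN addrA.
by repeat (congr (_ - _) || congr (_ + _) || congr (_ * _)); congr (M _ _); apply/val_inj.
Qed.

Section Conics.
Variable R : realType.
Implicit Types (a b c d e p u v w : 'rV[R]_3) (S : 'M[R]_3).

Definition coords v : R * R * R := (v 0 0, v 0 1, v 0 2%:R).
Notation br u v w := (bracket (coords u) (coords v) (coords w)).

Lemma mx11_sum3 (A : 'rV[R]_3) (B : 'cV[R]_3) :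
  (A *m B) 0 0 = A 0 0 * B 0 0 + A 0 1 * B 1 0 + A 0 2%:R * B 2%:R 0.
Proof.
rewrite mxE !big_ord_recl big_ord0 addr0 addrA.
by do !congr (_ + _ * _); rewrite ?lift0; congr (_ _ _); apply/val_inj.
Qed.

Lemma row3_eq v w : coords v = coords w -> v = w.
Proof.
case=> e0 e1 e2; apply/rowP => -[[|[|[|i]]] Hi] //.
- by rewrite (_ : Ordinal Hi = 0) //; apply/val_inj.
- by rewrite (_ : Ordinal Hi = 1) //; apply/val_inj.
- by rewrite (_ : Ordinal Hi = 2%:R) //; apply/val_inj.
Qed.

Definition row3 u v w : 'M[R]_3 := \matrix_(m < 3) nth 0 [:: u; v; w] m.

Lemma det_row3 u v w : \det (row3 u v w) = br u v w.
Proof. by rewrite det_mx33 !mxE. Qed.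

Lemma orientE u v w : orient u v w = br u v w.
Proof. exact: det_row3. Qed.

Lemma br_cramer a b c v :
  br a b c *: v = br b c v *: a - br a c v *: b + br a b v *: c.
Proof.
apply: row3_eq; rewrite /coords !mxE /=.
by congr (_, _, _); ring.
Qed.

Definition qform S u v : R := (u *m S *m v^T) 0 0.

Lemma qformDl S u v w : qform S (u + v) w = qform S u w + qform S v w.
Proof. by rewrite /qform !mulmxDl mxE. Qed.
Lemma qformZl S k u v : qform S (k *: u) v = k * qform S u v.
Proof. by rewrite /qform -!scalemxAl mxE. Qed.
Lemma qformDr S u v w : qform S u (v + w) = qform S u v + qform S u w.
Proof. by rewrite /qform linearD mulmxDr mxE. Qed.
Lemma qformZr S k u v : qform S u (k *: v) = k * qform S u v.
Proof. by rewrite /qform linearZ -scalemxAr mxE. Qed.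
Lemma qformC S u v : S^T = S -> qform S u v = qform S v u.
Proof.
move=> symS; rewrite /qform; transitivity ((u *m S *m v^T)^T 0 0); first by rewrite [RHS]mxE.
by rewrite !trmx_mul trmxK symS mulmxA.
Qed.

(** In the basis a, b, c the matrix of S has a zero diagonal; the coordinates of v are
    those of Cramer's rule. *)
Lemma qform_conic_basis S a b c v : S^T = S ->
  qform S a a = 0 -> qform S b b = 0 -> qform S c c = 0 ->
  br a b c ^+ 2 * qform S v v =
    2 * (br a b v * br b c v * qform S a c - br b c v * br a c v * qform S a b
         - br a c v * br a b v * qform S b c).
Proof.
move=> symS qa qb qc; rewrite expr2 -mulrA -qformZl -qformZr br_cramer.
rewrite -!scaleNr !(qformDl, qformDr, qformZl, qformZr) qa qb qc.
by rewrite (qformC b a symS) (qformC c a symS) (qformC c b symS); ring.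
Qed.

(** The right-hand side is the Gram determinant of u, v, w. *)
Lemma det_qform S u v w : S^T = S -> br u v w ^+ 2 * \det S =
  qform S u u * (qform S v v * qform S w w - qform S v w ^+ 2) -
  qform S u v * (qform S u v * qform S w w - qform S v w * qform S u w) +
  qform S u w * (qform S u v * qform S v w - qform S v v * qform S u w).
Proof.
move=> symS; transitivity (\det (row3 u v w *m S *m (row3 u v w)^T)).
  by rewrite !det_mulmx det_tr det_row3; ring.
have E i j : (row3 u v w *m S *m (row3 u v w)^T) i j =
             qform S (nth 0 [:: u; v; w] i) (nth 0 [:: u; v; w] j).
  rewrite /qform !mxE; apply: eq_bigr => k _; rewrite !mxE; congr (_ * _).
  by apply: eq_bigr => l _; rewrite !mxE.
by rewrite det_mx33 !E /= (qformC v u symS) (qformC w u symS) (qformC w v symS) expr2.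
Qed.

Definition cross u v : 'cV[R]_3 := \col_i [:: u 0 1 * v 0 2%:R - u 0 2%:R * v 0 1;
   u 0 2%:R * v 0 0 - u 0 0 * v 0 2%:R; u 0 0 * v 0 1 - u 0 1 * v 0 0]`_i.

Lemma mul_cross u v w : (w *m cross u v) 0 0 = br u v w.
Proof. by rewrite mx11_sum3 !mxE /=; ring. Qed.

Definition line_pair a b c d : 'M[R]_3 :=
  cross a b *m (cross c d)^T + cross c d *m (cross a b)^T.

Lemma line_pair_sym a b c d : (line_pair a b c d)^T = line_pair a b c d.
Proof. by rewrite linearD /= !trmx_mul !trmxK addrC. Qed.

Lemma qform_line_pair a b c d u v :
  qform (line_pair a b c d) u v = br a b u * br c d v + br c d u * br a b v.
Proof.
have mul11 (M N : 'M[R]_1) : (M *m N) 0 0 = M 0 0 * N 0 0.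
  by rewrite mxE big_ord_recl big_ord0 addr0.
have E p (l : 'cV[R]_3) : (l^T *m p^T) 0 0 = (p *m l) 0 0.
  by rewrite -trmx_mul [LHS]mxE.
rewrite /qform /line_pair mulmxDr mulmxDl mxE !mulmxA -!(mulmxA (_ *m _) _^T).
by rewrite !mul11 !E !mul_cross.
Qed.

(** A combination of two line pairs through a, b, c, d, with coefficients that make it
    vanish at e. *)
Definition conic5 a b c d e : 'M[R]_3 :=
  (br a b e * br c d e) *: line_pair a c b d -
  (br a c e * br b d e) *: line_pair a b c d.

Lemma conic5_sym a b c d e : (conic5 a b c d e)^T = conic5 a b c d e.
Proof. by rewrite /conic5 linearB /= !linearZ /= !line_pair_sym. Qed.

Lemma qform_conic5 a b c d e u v : qform (conic5 a b c d e) u v =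
  br a b e * br c d e * (br a c u * br b d v + br b d u * br a c v) -
  br a c e * br b d e * (br a b u * br c d v + br c d u * br a b v).
Proof.
rewrite -!qform_line_pair /qform /conic5 mulmxBr mulmxBl -!scalemxAr -!scalemxAl.
by rewrite [LHS]mxE [X in _ + X]mxE; congr (_ - _); rewrite [LHS]mxE.
Qed.

Lemma qform_conic5_diag a b c d e v :
  qform (conic5 a b c d e) v v =
  2 * hexad (coords a) (coords b) (coords c) (coords d) (coords e) (coords v).
Proof. by rewrite qform_conic5 /hexad; ring. Qed.

(** As a, b, c are isotropic for this matrix, its determinant and its form
    are determined by these three values. *)
Lemma qform_conic5_offdiag a b c d e :
  [/\ qform (conic5 a b c d e) a b = - (br a b e * br c d e * br a b c * br a b d),
      qform (conic5 a b c d e) a c = - (br a c e * br b d e * br a b c * br a c d) &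
      qform (conic5 a b c d e) b c = - (br a d e * br b c e * br a b c * br b c d) ].
Proof.
split; rewrite qform_conic5 !bracket0.
- rewrite (bracketC23 (coords a) (coords b)) -(bracket_cycle (coords a) (coords b) (coords d)).
  by ring.
- rewrite -(bracket_cycle (coords a) (coords c) (coords d)).
  by ring.
- rewrite (bracketC23 (coords a) (coords b)) (bracketC23 (coords b) (coords c)).
  rewrite (bracket_cycle (coords b) (coords c) (coords d)).
  have /eqP := plucker (coords a) (coords b) (coords c) (coords d) (coords e).
  rewrite addr_eq0 => /eqP P.
  transitivity (br a b c * br b c d * (br a b e * br c d e - br a c e * br b d e)).
    by ring.
  by rewrite P; ring.
Qed.

Definition prod10 a b c d e : R :=
  br a b c * br a b d * br a b e * br a c d * br a c e * br a d e *
  br b c d * br b c e * br b d e * br c d e.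

(** In the basis a, b, c the form of S has a zero diagonal.  The points d and e impose two
    independent linear equations on the three other coefficients, which leaves the single
    parameter t. *)
Lemma conic5_unique S a b c d e :
    S^T = S -> prod10 a b c d e != 0 ->
    [/\ qform S a a = 0, qform S b b = 0, qform S c c = 0, qform S d d = 0 & qform S e e = 0] ->
  exists t,
    (forall v, qform S v v =
       2 * t * hexad (coords a) (coords b) (coords c) (coords d) (coords e) (coords v)) /\
    \det S = - 2 * t ^+ 3 * prod10 a b c d e.
Proof.
move=> symS nz [qa qb qc qd qe].
have := nz; rewrite /prod10 !mulf_eq0 !negb_or.
do 9 case/andP; move=> abc abd abe acd ace ade bcd bce bde cde.
have Bd := qform_conic_basis d symS qa qb qc; rewrite qd mulr0 in Bd.
have Be := qform_conic_basis e symS qa qb qc; rewrite qe mulr0 in Be.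
have Pa := plucker_fst (coords a) (coords b) (coords c) (coords d) (coords e).
have Pb := plucker_mid (coords a) (coords b) (coords c) (coords d) (coords e).
have Pc := plucker_third (coords a) (coords b) (coords c) (coords d) (coords e).
have [Fab Fac Fbc] := qform_conic5_offdiag a b c d e.
pose t := - qform S b c / (br a d e * br b c e * br a b c * br b c d).
have Tbc : qform S b c = t * qform (conic5 a b c d e) b c.
  by rewrite Fbc /t; field; rewrite abc ade bce bcd.
have Tac : qform S a c = t * qform (conic5 a b c d e) a c.
  rewrite Fac /t; apply/eqP; rewrite -subr_eq0; apply/eqP.
  (* The equations Bd and Be at d and e are combined so that C disappears; the relations Pa
     and Pb turn the remaining coefficients into products of brackets. *)
  move: Bd Be Pa Pb; set A := qform S b c; set B := qform S a c; set C := qform S a b.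
  set Xd := _ * _ => Bd; set Xe := _ * _ => Be; set Ya := _ + _ => Pa; set Yb := _ + _ => Pb.
  transitivity ((Xd * (br b c e * br a c e) / 2 - Xe * (br b c d * br a c d) / 2
     + B * br b c d * br b c e * Ya - A * br a c d * br a c e * Yb) /
     (br b c d * br b c e * br a b c * br a d e)).
    by rewrite /Xd /Xe /Ya /Yb; field; rewrite abc ade bce bcd.
  by rewrite -Bd -Be Pa Pb; ring.
have Tab : qform S a b = t * qform (conic5 a b c d e) a b.
  rewrite Fab /t; apply/eqP; rewrite -subr_eq0; apply/eqP.
  (* Here B disappears, with the relations Pa and Pc. *)
  move: Bd Be Pa Pc; set A := qform S b c; set B := qform S a c; set C := qform S a b.
  set Xd := _ * _ => Bd; set Xe := _ * _ => Be; set Ya := _ + _ => Pa; set Yc := _ + _ => Pc.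
  transitivity ((Xd * (br a b e * br b c e) / 2 - Xe * (br a b d * br b c d) / 2
     + C * br b c d * br b c e * Ya - A * br a b d * br a b e * Yc) /
     (br b c d * br b c e * br a b c * br a d e)).
    by rewrite /Xd /Xe /Ya /Yc; field; rewrite abc ade bce bcd.
  by rewrite -Bd -Be Pa Pc; ring.
have C0 x : x \in [:: a; b; c] -> qform (conic5 a b c d e) x x = 0.
  rewrite qform_conic5_diag !inE => /or3P[] /eqP ->; rewrite /hexad !bracket0; ring.
exists t; split=> [v|]; apply: (mulfI (expf_neq0 2 abc)).
  transitivity (br a b c ^+ 2 * (t * qform (conic5 a b c d e) v v)); last first.
    by rewrite qform_conic5_diag; ring.
  rewrite qform_conic_basis // [RHS]mulrCA qform_conic_basis ?conic5_sym ?C0 ?inE ?eqxx ?orbT //.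
  by rewrite Tab Tac Tbc; ring.
rewrite det_qform // qa qb qc Tab Tac Tbc Fab Fac Fbc /prod10; ring.
Qed.
End Conics.

(** * Continuous maps from and to the projective plane *)

Import numFieldNormedType.Exports.
Local Open Scope classical_set_scope.
Local Open Scope quotient_scope.
Local Open Scope ring_scope.

Lemma cts_cst (X Y : topologicalType) (k : Y) : continuous (fun _ : X => k).
Proof. exact: cst_continuous. Qed.

Section Continuity.
Variables (R : realType) (X : topologicalType).
Implicit Types f g : X -> R.

Lemma ctsD f g : continuous f -> continuous g -> continuous (fun x => f x + g x).
Proof. by move=> cf cg x; apply: cvgD; [exact: cf|exact: cg]. Qed.
Lemma ctsN f : continuous f -> continuous (fun x => - f x).
Proof. by move=> cf x; apply: cvgN; exact: cf. Qed.
Lemma ctsM f g : continuous f -> continuous g -> continuous (fun x => f x * g x).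
Proof. by move=> cf cg x; apply: cvgM; [exact: cf|exact: cg]. Qed.
Lemma ctsX f n : continuous f -> continuous (fun x => f x ^+ n).
Proof.
move=> cf; elim: n => [|n IHn]; first by under eq_fun do rewrite expr0; exact: cts_cst.
by under eq_fun do rewrite exprS; exact: ctsM.
Qed.
Lemma cts_max f g : continuous f -> continuous g -> continuous (fun x => Num.max (f x) (g x)).
Proof. by move=> cf cg x; apply: continuous_max; [exact: cf|exact: cg]. Qed.
Lemma ctsV f : (forall x, f x != 0) -> continuous f -> continuous (fun x => (f x)^-1).
Proof. by move=> nz cf x; apply: cvgV => //; exact: cf. Qed.

Lemma cts_mx m n (F : X -> 'M[R]_(m, n)) :
  (forall i j, continuous (fun x => F x i j)) -> continuous F.
Proof.
move=> cF x U [P nP sPU]; apply: (filterS (P := fun y => forall i j, P i j (F y i j))).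
  by move=> y; exact: sPU.
by apply: filter_forall => i; apply: filter_forall => j; apply: cF; exact: nP.
Qed.

Lemma cts_coord m n (F : X -> 'M[R]_(m, n)) i j :
  continuous F -> continuous (fun x => F x i j).
Proof.
move=> cF x; apply: (continuous_comp (g := fun M : 'M_(m, n) => M i j)); first exact: cF.
exact: coord_continuous.
Qed.
End Continuity.

Section ContinuityComp.
Variables X Y Z : topologicalType.

Lemma cts_id : continuous (fun x : X => x).
Proof. by move=> x; exact: cvg_id. Qed.
Lemma cts_comp (g : Y -> Z) (f : X -> Y) :
  continuous g -> continuous f -> continuous (fun x => g (f x)).
Proof. by move=> cg cf x; apply: continuous_comp; [exact: cf|exact: cg]. Qed.
Lemma cts_pair (f : X -> Y) (g : X -> Z) :
  continuous f -> continuous g -> continuous (fun x => (f x, g x)).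
Proof. by move=> cf cg x; apply: cvg_pair; [exact: cf|exact: cg]. Qed.
Lemma cts_fst (f : X -> Y * Z) : continuous f -> continuous (fun x => (f x).1).
Proof. by move=> cf x; apply: (continuous_comp (g := fst)); [exact: cf|exact: cvg_fst]. Qed.
Lemma cts_snd (f : X -> Y * Z) : continuous f -> continuous (fun x => (f x).2).
Proof. by move=> cf x; apply: (continuous_comp (g := snd)); [exact: cf|exact: cvg_snd]. Qed.
Lemma cts_val (A : set Y) (f : X -> A) :
  continuous f -> continuous (fun x => val (f x)).
Proof.
move=> cf x; apply: (continuous_comp (g := set_val)); first exact: cf.
exact: initial_continuous.
Qed.
End ContinuityComp.

Section ProjectivePlane.
Variable R : realType.
Notation RP2 := (RP2 R).
Notation vec := 'rV[R]_3.

Definition rp2_pt (v : vec) (nz : v != 0) : RP2 :=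
  \pi_(quotient_topology {eq_quot (@same_line R)}) (exist _ v (mem_set nz) : nonzero_vec R).

Lemma hcoord_neq0 (p : RP2) : hcoord p != 0.
Proof. by rewrite /hcoord; case: (repr p) => v /= /set_mem. Qed.

Lemma hcoord_rp2_pt v (nz : v != 0) : exists2 k, k != 0 & hcoord (rp2_pt nz) = k *: v.
Proof.
have /eqmodP/andP[/sub_rVP[k kE] _] :
    repr (rp2_pt nz) = exist _ v (mem_set nz) %[mod {eq_quot (@same_line R)}].
  by rewrite reprK.
exists k => //; apply/eqP => k0; move: (hcoord_neq0 (rp2_pt nz)).
by rewrite /hcoord kE k0 scale0r eqxx.
Qed.

Lemma rp2_pt_scale v w (nzv : v != 0) (nzw : w != 0) k : v = k *: w -> rp2_pt nzv = rp2_pt nzw.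
Proof.
move=> E; apply/eqmodP; rewrite /= /same_line /=; apply/andP; split; apply/sub_rVP.
  by exists k.
exists k^-1; rewrite E scalerA mulVf ?scale1r //.
by apply: contraNneq nzv => k0; rewrite E k0 scale0r.
Qed.

Lemma rp2_pt_hcoord p : rp2_pt (hcoord_neq0 p) = p.
Proof.
rewrite -[RHS]reprK; apply/eqmodP; rewrite /= /same_line /=; by rewrite submx_refl.
Qed.

Lemma cts_rp2_pt (X : topologicalType) (F : X -> vec) (nz : forall x, F x != 0) :
  continuous F -> continuous (fun x => rp2_pt (nz x)).
Proof.
move=> cF x; pose Q := quotient_topology {eq_quot (@same_line R)}.
apply: (continuous_comp (g := \pi_Q)); last exact: pi_continuous.
by apply: continuous_comp_initial; exact: cF.
Qed.

(** A ratio that is invariant under scaling does not see which representative [hcoord]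
    chooses. *)
Lemma cts_ratio (f g : vec -> R) :
  continuous f -> continuous g -> (forall v, v != 0 -> g v != 0) ->
  (forall k v, k != 0 -> f (k *: v) / g (k *: v) = f v / g v) ->
  continuous (fun p : RP2 => f (hcoord p) / g (hcoord p)).
Proof.
move=> cf cg gnz fg.
apply: (@repr_comp_continuous _ _ _ (fun v : nonzero_vec R => f (val v) / g (val v))).
  have cval : continuous (val : nonzero_vec R -> vec) by exact: initial_continuous.
  apply: ctsM; last apply: ctsV => [[v /= /set_mem]|]; [|exact: gnz|].
    by move=> x; apply: continuous_comp; [exact: cval|exact: cf].
  by move=> x; apply: continuous_comp; [exact: cval|exact: cg].
move=> v w /eqP/eqmodP/andP[/sub_rVP[k kE] _]; rewrite kE fg //.
apply/eqP => k0; case: v kE => v /= /set_mem /eqP + E.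
by rewrite E k0 scale0r.
Qed.
End ProjectivePlane.

(** * Lifting a homotopy of loops *)

Section LoopsOfLines.
Variable R : realType.
Notation RP2 := (RP2 R).
Notation vec := 'rV[R]_3.
Implicit Types (u v w : vec) (p q : RP2).

Definition dot u v : R := u 0 0 * v 0 0 + u 0 1 * v 0 1 + u 0 2%:R * v 0 2%:R.

Lemma dotZl k u v : dot (k *: u) v = k * dot u v.
Proof. by rewrite /dot !mxE; ring. Qed.
Lemma dotZr k u v : dot u (k *: v) = k * dot u v.
Proof. by rewrite /dot !mxE; ring. Qed.

Lemma dot_gt0 v : v != 0 -> 0 < dot v v.
Proof.
move=> nz; rewrite lt_def; apply/andP; split; last by rewrite /dot -!expr2 !addr_ge0 ?sqr_ge0.
apply: contra nz; rewrite /dot -!expr2 !paddr_eq0 ?addr_ge0 ?sqr_ge0 // !sqrf_eq0.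
move=> /andP[/andP[/eqP v0 /eqP v1] /eqP v2]; apply/eqP/row3_eq.
by rewrite /coords v0 v1 v2 !mxE.
Qed.

Lemma cts_dot (X : topologicalType) (F G : X -> vec) :
  continuous F -> continuous G -> continuous (fun x => dot (F x) (G x)).
Proof.
move=> cF cG; rewrite /dot.
by apply: ctsD; [apply: ctsD|]; apply: ctsM; apply: cts_coord.
Qed.

(** The orthogonal projection of u onto the line p depends continuously on p and u, although
    no continuous choice of a direction vector of p exists. *)
Definition line_proj p u : vec := (dot u (hcoord p) / dot (hcoord p) (hcoord p)) *: hcoord p.

Definition proj_entry i j p : R := hcoord p 0 i * hcoord p 0 j / dot (hcoord p) (hcoord p).

Lemma cts_proj_entry i j : continuous (proj_entry i j).
Proof.
apply: (@cts_ratio R (fun v => v 0 i * v 0 j) (fun v => dot v v)).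
- by apply: ctsM; apply: cts_coord ; exact: cts_id.
- by apply: cts_dot ; exact: cts_id.
- by move=> v /dot_gt0; exact: lt0r_neq0.
- move=> k v k0; rewrite dotZl dotZr !mxE.
  by rewrite /= mulrACA (mulrA k k) -mulf_div divff ?mul1r // mulf_neq0.
Qed.

Lemma line_projE p u j : line_proj p u 0 j =
  u 0 0 * proj_entry 0 j p + u 0 1 * proj_entry 1 j p + u 0 2%:R * proj_entry 2%:R j p.
Proof. by rewrite /line_proj /proj_entry !mxE {1}/dot; ring. Qed.

Lemma cts_line_proj (X : topologicalType) (P : X -> RP2) (F : X -> vec) :
  continuous P -> continuous F -> continuous (fun x => line_proj (P x) (F x)).
Proof.
move=> cP cF; apply: cts_mx => i j; rewrite ord1.
under eq_fun do rewrite line_projE.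
have cE k l : continuous (fun x => proj_entry k l (P x)).
  exact: cts_comp (@cts_proj_entry k l) cP.
by apply: ctsD; [apply: ctsD|]; apply: ctsM => //; apply: cts_coord.
Qed.

(** The square of the cosine of the angle between the two lines. *)
Definition cos2 p q : R :=
  dot (hcoord p) (hcoord q) ^+ 2 / (dot (hcoord p) (hcoord p) * dot (hcoord q) (hcoord q)).

Lemma cos2_refl p : cos2 p p = 1.
Proof.
have := dot_gt0 (hcoord_neq0 p); move/lt0r_neq0 => nz.
by rewrite /cos2 expr2 divff // mulf_neq0.
Qed.

Lemma cts_cos2 (X : topologicalType) (P Q : X -> RP2) :
  continuous P -> continuous Q -> continuous (fun x => cos2 (P x) (Q x)).
Proof.
move=> cP cQ.
pose E i j x := proj_entry i j (P x) * proj_entry i j (Q x).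
have -> : (fun x => cos2 (P x) (Q x)) = (fun x =>
   (E 0 0 x + E 1 1 x + E 2%:R 2%:R x) + (E 0 1 x + E 1 0 x + E 0 2%:R x) +
   (E 2%:R 0 x + E 1 2%:R x + E 2%:R 1 x)).
  by apply/funext => x; rewrite /cos2 /E /proj_entry invfM {1}/dot; ring.
have cE i j : continuous (E i j).
  by apply: ctsM; apply: cts_comp => //; exact: cts_proj_entry.
by do !apply: ctsD.
Qed.

(** A loop of lines that shrinks to a constant lifts to a closed path of vectors.  Start from
    a constant vector at time 0 and project successively onto the lines at the times
    1/(n+1), 2/(n+1), ..., 1.  By compactness consecutive lines are not orthogonal when n is
    large, so that no vector vanishes; and the projections preserve the equality of the
    vectors at the two ends of the loop. *)
Lemma lift_homotopy (G : R * R -> RP2) :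
  continuous G -> (forall t, G (0, t) = G (0, 0)) -> (forall s, G (s, -1) = G (s, 1)) ->
  exists2 u : R -> vec, continuous u &
    u (-1) = u 1 /\
    forall t : R, t \in `[-1, 1] -> exists2 k, k != 0 & u t = k *: hcoord (G (1, t)).
Proof.
move=> cG G0 Gper.
have step : exists n : nat, forall (k : nat) (t : R), (k < n.+1)%N -> t \in `[-1, 1] ->
    cos2 (G (k%:R / n.+1%:R, t)) (G (k.+1%:R / n.+1%:R, t)) != 0.
  pose K := `[(0 : R), 1] `*` `[(-1 : R), 1].
  have cK : compact K by apply: compact_setX; exact: segment_compact.
  pose Psi (z : (R * R) * R) := cos2 (G z.1) (G (z.1.1 + z.2, z.1.2)).
  have cPsi : continuous Psi.
    have c1 : continuous (fun z : (R * R) * R => z.1) by apply: cts_fst; exact: cts_id.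
    apply: cts_cos2; apply: cts_comp => //; apply: cts_pair; last exact: cts_snd.
    by apply: ctsD; [exact: cts_fst|apply: cts_snd; exact: cts_id].
  have /compact_near_coveringP/(_ _ (nbhs (0 : R)) (fun d x => Psi (x, d) != 0)) cov := cK.
  have : \forall d \near (0 : R), K `<=` (fun x => Psi (x, d) != 0).
    apply: cov => x _.
    apply: (cPsi (x, 0) [set y | y != 0]); apply: open_nbhs_nbhs; split.
      exact: open_neq.
    by rewrite /= /Psi /= addr0 -surjective_pairing cos2_refl oner_neq0.
  move=> /nbhs_ballP[e /= e0 eP].
  have [n] := ltr_add_invr e0; rewrite add0r => ne.
  exists n => k t kn tI.
  have n0 : 0 < n.+1%:R :> R by rewrite ltr0n.
  have bn : ball (0 : R) e n.+1%:R^-1.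
    by rewrite /ball /= sub0r normrN ger0_norm // invr_ge0 ltW.
  have := eP _ bn (k%:R / n.+1%:R, t).
  rewrite /Psi /= -[k.+1%:R]natr1 mulrDl mul1r; apply; split; last exact: tI.
  rewrite /= in_itv /= divr_ge0 ?ler0n //= ler_pdivrMr // mul1r ler_nat; exact: ltnW.
have [n Hn] := step.
pose u := fix u k t := if k is k'.+1 then line_proj (G (k%:R / n.+1%:R, t)) (u k' t)
                       else hcoord (G (0, 0)).
have cu k : continuous (u k).
  elim: k => [|k IHk]; first exact: cst_continuous.
  apply: cts_line_proj => //; apply: cts_comp => //.
  by apply: cts_pair; [exact: cts_cst|exact: cts_id].
exists (u n.+1) => //; split.
  by elim: (n.+1) => [|k IHk] //=; rewrite Gper IHk.
have lift k (t : R) : (k <= n.+1)%N -> t \in `[-1, 1] ->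
    exists2 c, c != 0 & u k t = c *: hcoord (G (k%:R / n.+1%:R, t)).
  move=> + tI; elim: k => [_|k IHk kn].
    exists 1; rewrite ?oner_eq0 //= mul0r.  by rewrite (G0 t) scale1r.
  have [c c0 E] := IHk (ltnW kn); rewrite /= /line_proj E dotZl.
  eexists; last reflexivity.
  have := Hn k t kn tI; rewrite /cos2 mulf_eq0 negb_or sqrf_eq0 => /andP[d0 _].
  rewrite !mulf_neq0 // invr_eq0; apply: lt0r_neq0; exact: dot_gt0 (hcoord_neq0 _).
move=> t tI; have := lift n.+1 t (leqnn _) tI.
by rewrite divff // pnatr_eq0.
Qed.
End LoopsOfLines.

(** * A disc contains no one-sided loop *)

Section OneSidedLoops.
Variable R : realType.
Notation RP2 := (RP2 R).
Notation vec := 'rV[R]_3.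
Implicit Types (u v w : vec) (p q : RP2).

(** A map of R to [-1, 1] that fixes 0 and 1: it allows homotopies to be parametrized by the
    whole line. *)
Definition shrink (s : R) : R := 2 * s / (1 + s ^+ 2).

Lemma shrink0 : shrink 0 = 0.
Proof. by rewrite /shrink mulr0 mul0r. Qed.

Lemma shrink1 : shrink 1 = 1.
Proof. by rewrite /shrink; field. Qed.

Lemma cts_shrink : continuous shrink.
Proof.
apply: ctsM; first by apply: ctsM; [exact: cts_cst|exact: cts_id].
apply: ctsV; last by apply: ctsD; [exact: cts_cst|apply: ctsX; exact: cts_id].
by move=> z; rewrite lt0r_neq0 // ltr_pwDl // sqr_ge0.
Qed.

Lemma shrink_disc (s : R) (z : R * R) :
  disc z -> disc (shrink s * z.1, shrink s * z.2).
Proof.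
rewrite /disc /= => z1; rewrite /shrink; set c := _ / _.
have c1 : c ^+ 2 <= 1.
  have d0 : 0 < (1 + s ^+ 2) ^+ 2 by rewrite exprn_gt0 // ltr_pwDl // sqr_ge0.
  rewrite /c exprMn exprVn ler_pdivrMr // mul1r -subr_ge0.
  have -> : (1 + s ^+ 2) ^+ 2 - (2 * s) ^+ 2 = (1 - s ^+ 2) ^+ 2 by ring.
  exact: sqr_ge0.
rewrite (exprMn _ c) (exprMn _ c) -mulrDr; apply: le_lt_trans z1.
by apply: ler_piMl => //; rewrite addr_ge0 ?sqr_ge0.
Qed.

(** A homeomorphism to the disc lets the loop shrink to the centre, so that it lifts to a
    closed path u of vectors by [lift_homotopy].  As u t is a nonzero multiple of c t while
    u (-1) = u 1 and c (-1) = - c 1, the scalar product of u and c changes its sign without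
    vanishing. *)
Lemma one_sided_not_disc (A : set RP2) (c : R -> vec) (nz : forall t, c t != 0) :
  continuous c -> c (-1) = - c 1 -> (forall t, A (rp2_pt (nz t))) ->
  ~ homeomorphic A (disc (R := R)).
Proof.
move=> cc cN cA [f [g [cf cg fK gK]]].
pose a t : A := SigSub (mem_set (cA t)).
have ca : continuous a.
  apply: continuous_comp_initial; exact: cts_rp2_pt.
pose sc (z : R * R) : disc (R := R) :=
  SigSub (mem_set (shrink_disc z.1 (set_mem (valP (f (a z.2)))))).
have csc : continuous sc.
  apply: continuous_comp_initial => /=.
  have cfa : continuous (fun z : R * R => val (f (a z.2))).
    apply: cts_val; apply: cts_comp => //; apply: cts_comp => //.
    by apply: cts_snd; exact: cts_id.
  have cs : continuous (fun z : R * R => shrink z.1).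
    by apply: cts_comp; [exact: cts_shrink|apply: cts_fst; exact: cts_id].
  apply: cts_pair; apply: ctsM => //; [exact: cts_fst|exact: cts_snd].
pose G z := val (g (sc z)).
have [||s|u cu [uN uG]] := @lift_homotopy R G.
- by apply: cts_val; exact: cts_comp.
- move=> t; rewrite /G; congr (val (g _)); apply/val_inj => /=.
  by rewrite shrink0 !mul0r.
- rewrite /G; congr (val (g _)); apply/val_inj => /=.
  have -> : a (-1) = a 1 => //.
  by apply/val_inj/(@rp2_pt_scale _ _ _ _ _ (-1)); rewrite cN scaleN1r.
have G1 t : G (1, t) = rp2_pt (nz t).
  rewrite /G (_ : sc (1, t) = f (a t)) ?fK //.
  by apply/val_inj; rewrite /= shrink1 !mul1r -surjective_pairing.
pose d t := dot (u t) (c t).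
have cd : continuous d by exact: cts_dot.
have dN : d (-1) = - d 1 by rewrite /d uN cN -scaleN1r dotZr mulN1r.
have le11 : (-1 : R) <= 1 by lra.
have [|t tI d0] := @IVT R d (-1) 1 0 le11 (continuous_subspaceT cd).
  rewrite dN ge_min le_max; case: (leP (d 1) 0) => d1; first by rewrite orbT oppr_ge0 d1.
  by rewrite oppr_le0 (ltW d1) orbT.
have [k k0 E] := uG t tI; have [l l0 E'] := hcoord_rp2_pt (nz t).
move/eqP: d0; rewrite /d E G1 E' !dotZl !mulf_eq0 (negPf k0) (negPf l0) /=.
by rewrite (negPf (lt0r_neq0 (dot_gt0 (nz t)))).
Qed.
End OneSidedLoops.

(** * The inside of a conic *)

Section InsideConic.
Variable R : realType.
Notation RP2 := (RP2 R).
Notation vec := 'rV[R]_3.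
Implicit Types (a b c u v w x : vec) (p q : RP2) (S : 'M[R]_3).
Notation br u v w := (bracket (coords u) (coords v) (coords w)).

Lemma qform_scale k S u v : qform (k *: S) u v = k * qform S u v.
Proof. by rewrite /qform -scalemxAr -scalemxAl [LHS]mxE. Qed.

Definition zero_set S : set RP2 := [set p | qform S (hcoord p) (hcoord p) = 0].

Lemma zero_setZ k S : k != 0 -> zero_set (k *: S) = zero_set S.
Proof.
move=> k0; apply/seteqP; split=> p; rewrite /zero_set /= qform_scale.
  by move/eqP; rewrite mulf_eq0 (negPf k0) => /eqP.
by move=> ->; rewrite mulr0.
Qed.

Lemma binet_cauchy u v w x :
  br u v (cross w x)^T =
  (w *m u^T) 0 0 * (x *m v^T) 0 0 - (w *m v^T) 0 0 * (x *m u^T) 0 0.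
Proof. by rewrite !mx11_sum3 /coords !mxE /=; ring. Qed.

(** One of the isotropic vectors a, b, c is not orthogonal to e; its component u orthogonal
    to e is negative.  The cross product v of the rows e S and u S is orthogonal to e and u,
    and the Gram determinant of e, u, v gives its sign. *)
Lemma polar_frame S e a b c :
    S^T = S -> 0 < qform S e e -> \det S != 0 -> br a b c != 0 ->
    qform S a a = 0 -> qform S b b = 0 -> qform S c c = 0 ->
  exists u v, [/\ qform S e u = 0, qform S e v = 0 & qform S u v = 0] /\
    [/\ qform S u u < 0, qform S v v * \det S < 0 & br e u v != 0].
Proof.
move=> symS e0 detS abc qa qb qc.
have [w w0 we] : exists2 w, qform S w w = 0 & qform S w e != 0.
  case: (eqVneq (qform S a e) 0) => [ae|]; last by exists a.
  case: (eqVneq (qform S b e) 0) => [be|]; last by exists b.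
  case: (eqVneq (qform S c e) 0) => [ce|]; last by exists c.
  have : br a b c * qform S e e = 0.
    rewrite -qformZl br_cramer -scaleNr !(qformDl, qformZl) ae be ce; ring.
  by move/eqP; rewrite mulf_eq0 (negPf abc) (negPf (lt0r_neq0 e0)).
have ee := lt0r_neq0 e0.
pose u := w - (qform S w e / qform S e e) *: e.
have eu : qform S e u = 0.
  by rewrite /u -scaleNr qformDr qformZr (qformC e w symS); field.
have uu : qform S u u < 0.
  have -> : qform S u u = - (qform S w e ^+ 2 / qform S e e).
    rewrite {1}/u -scaleNr qformDl qformZl eu mulr0 addr0 /u -scaleNr qformDr qformZr w0.
    by field.
  by rewrite oppr_lt0 divr_gt0 // exprn_even_gt0.
pose v := (cross (e *m S) (u *m S))^T.
have orth x : qform S x v = br (e *m S) (u *m S) (x *m S).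
  by rewrite /qform /v trmxK mul_cross.
have ev : qform S e v = 0 by rewrite orth (bracket0 (coords (e *m S)) _).1.2.
have uv : qform S u v = 0 by rewrite orth (bracket0 (coords (u *m S)) _).2.
have binet : br e u v = qform S e e * qform S u u.
  transitivity (qform S e e * qform S u u - qform S e u * qform S u e); last first.
    by rewrite eu mul0r subr0.
  exact: binet_cauchy.
have euv : br e u v != 0 by rewrite binet mulf_neq0 // ltr0_neq0.
exists u, v; split=> //.
have D := det_qform e u v symS; rewrite eu ev uv in D.
have D' : qform S v v * \det S * (qform S e e * qform S u u) = (br e u v * \det S) ^+ 2.
  by rewrite exprMn (expr2 (\det S)) [RHS]mulrA D; ring.
have nz : br e u v * \det S != 0 by exact: mulf_neq0.
have : 0 < (br e u v * \det S) ^+ 2 by rewrite exprn_even_gt0 // nz.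
by rewrite -D' nmulr_lgt0 // pmulr_rlt0.
Qed.

Lemma hcoord_point p v (nz : v != 0) k : v = k *: hcoord p -> rp2_pt nz = p.
Proof. by move=> E; rewrite -[RHS]rp2_pt_hcoord; exact: rp2_pt_scale E. Qed.

(** The plane spanned by p and v is positive for S: it is a projective line that avoids the
    conic, and c runs along it from - p to p. *)
Lemma exterior_not_disc S p v :
    S^T = S -> 0 < qform S (hcoord p) (hcoord p) -> 0 < qform S v v ->
    qform S (hcoord p) v = 0 ->
  ~ homeomorphic (connected_component (~` zero_set S) p) (disc (R := R)).
Proof.
move=> symS p0 v0 pv.
pose c (t : R) : vec := t *: hcoord p + (1 - t ^+ 2) *: v.
have qc t : 0 < qform S (c t) (c t).
  rewrite /c !(qformDl, qformDr, qformZl, qformZr) (qformC v _ symS) pv !mulr0 addr0 add0r.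
  have -> : forall x y : R, t * (t * x) + (1 - t ^+ 2) * ((1 - t ^+ 2) * y) =
            t ^+ 2 * x + (1 - t ^+ 2) ^+ 2 * y by move=> x y; ring.
  have [->|t0] := eqVneq t 0; first by rewrite expr0n subr0 expr1n mul0r add0r mul1r.
  apply: ltr_pwDl; first by apply: mulr_gt0 => //; rewrite exprn_even_gt0.
  by apply: mulr_ge0; [exact: sqr_ge0|exact: ltW].
have nz t : c t != 0.
  by apply: contraTneq (qc t) => ->; rewrite /qform mul0mx mul0mx mxE ltxx.
have cc : continuous c.
  apply: cts_mx => i j; rewrite /c.
  under eq_fun do rewrite !mxE.
  apply: ctsD; apply: ctsM; try exact: cts_cst; try exact: cts_id.
  by apply: ctsD; [exact: cts_cst|apply: ctsN; apply: ctsX; exact: cts_id].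
apply: (@one_sided_not_disc R _ c nz cc).
  by rewrite /c sqrrN expr1n subrr !scale0r !addr0 scaleN1r scale1r.
move=> t; pose B := range (fun t => rp2_pt (nz t)).
have cB : connected B.
  apply: connected_continuous_connected; last by apply: continuous_subspaceT; exact: cts_rp2_pt.
  by apply/connected_intervalP => ? ? ? ? ? ?.
apply: (@connected_component_max _ _ B) => //; last by exists t.
  by exists 1 => //; apply: (@hcoord_point _ _ _ 1); rewrite /c expr1n subrr scale0r addr0.
move=> _ [s _ <-]; rewrite /zero_set /=.
have [k k0 ->] := hcoord_rp2_pt (nz s); rewrite qformZl qformZr => /eqP.
by rewrite !mulf_eq0 (negPf k0) (negPf (lt0r_neq0 (qc s))).
Qed.

Definition positive_part S : set RP2 := [set p | 0 < qform S (hcoord p) (hcoord p)].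

(** The form divided by the squared length is a continuous function on the projective
    plane, which keeps its sign on a connected set that avoids the conic. *)
Lemma component_positive S p : 0 < qform S (hcoord p) (hcoord p) ->
  connected_component (~` zero_set S) p `<=` positive_part S.
Proof.
move=> p0; pose phi (q : RP2) := qform S (hcoord q) (hcoord q) / dot (hcoord q) (hcoord q).
have cphi : continuous phi.
  apply: (@cts_ratio R (fun v => qform S v v) (fun v => dot v v)).
  - have -> : (fun v => qform S v v) = fun v => \sum_j (\sum_i v 0 i * S i j) * v 0 j.
      apply/funext => v; rewrite /qform mxE; apply: eq_bigr => j _; rewrite !mxE.
      by congr (_ * _).
    have csum (F : 'I_3 -> vec -> R) : (forall i, continuous (F i)) ->
        continuous (fun v => \sum_i F i v).
      move=> cF; under eq_fun do rewrite !big_ord_recl big_ord0.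
      by do 3!(apply: ctsD => //); exact: cts_cst.
    apply: (csum (fun j v => _)) => j; apply: ctsM; last by apply: cts_coord; exact: cts_id.
    apply: (csum (fun i v => _)) => i; apply: ctsM; last exact: cts_cst.
    by apply: cts_coord; exact: cts_id.
  - by apply: cts_dot; exact: cts_id.
  - by move=> v /dot_gt0; exact: lt0r_neq0.
  - move=> k v k0; rewrite qformZl qformZr dotZl dotZr.
    by rewrite !mulrA -mulf_div divff ?mul1r // mulf_neq0.
have dot0 q : 0 < dot (hcoord q) (hcoord q) by apply: dot_gt0; exact: hcoord_neq0.
set A := connected_component _ _.
have /connected_intervalP intA : connected (phi @` A).
  apply: connected_continuous_connected; first exact: component_connected.
  exact: continuous_subspaceT.
have AC : A `<=` ~` zero_set S by exact: connected_component_sub.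
have Ap : A p.
  by apply: connected_component_refl; rewrite /zero_set /= => E; rewrite E ltxx in p0.
move=> q Aq; rewrite /positive_part /= ltNge; apply/negP => q0.
have le0 : phi q <= 0 <= phi p.
  rewrite /phi; apply/andP; split; first by rewrite pmulr_lle0 // invr_gt0.
  by rewrite ltW // divr_gt0.
have [r Ar /eqP] := intA _ _ (ex_intro2 _ _ q Aq erefl) (ex_intro2 _ _ p Ap erefl) 0 le0.
rewrite /phi mulf_eq0 invr_eq0 (negPf (lt0r_neq0 (dot0 r))) orbF => /eqP.
exact: AC.
Qed.

Section Hyperboloid.
Variables (S : 'M[R]_3) (e u v : vec).
Hypotheses (symS : S^T = S) (nz : br e u v != 0).
Hypotheses (eu : qform S e u = 0) (ev : qform S e v = 0) (uv : qform S u v = 0).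
Hypotheses (ee : qform S e e = 1) (uu : qform S u u = - 1) (vv : qform S v v = - 1).

Let x w := qform S e w.
Let y w := - qform S u w.
Let z w := - qform S v w.

Let xyz w : w = x w *: e + y w *: u + z w *: v.
Proof.
have [k [l [m E]]] : exists k l m, w = k *: e + l *: u + m *: v.
  exists (br u v w / br e u v), (- (br e v w / br e u v)), (br e u w / br e u v).
  apply: (scalerI nz); rewrite br_cramer !scalerDr !scalerA -scaleNr.
  by congr (_ *: _ + _ *: _ + _ *: _); field.
rewrite /x /y /z {2 3 4}E !(qformDr, qformZr) eu ev uv (qformC u e symS).
rewrite (qformC v e symS) (qformC v u symS) eu ev uv ee uu vv {1}E.
by congr (_ *: _ + _ *: _ + _ *: _); ring.
Qed.

Let Q w : qform S w w = x w ^+ 2 - (y w ^+ 2 + z w ^+ 2).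
Proof.
rewrite {1 2}(xyz w) !(qformDl, qformDr, qformZl, qformZr) (qformC u e symS).
by rewrite (qformC v e symS) (qformC v u symS) eu ev uv ee uu vv; ring.
Qed.

Let xZ k w : x (k *: w) = k * x w. Proof. exact: qformZr. Qed.
Let yZ k w : y (k *: w) = k * y w. Proof. by rewrite /y qformZr mulrN. Qed.
Let zZ k w : z (k *: w) = k * z w. Proof. by rewrite /z qformZr mulrN. Qed.

Let chart (t : R * R) : vec := e + t.1 *: u + t.2 *: v.

Let xyz_chart t : [/\ x (chart t) = 1, y (chart t) = t.1 & z (chart t) = t.2].
Proof.
rewrite /x /y /z /chart !(qformDr, qformZr) eu ev uv (qformC u e symS).
by rewrite (qformC v e symS) (qformC v u symS) eu ev uv ee uu vv; split; ring.
Qed.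

Let chart_nz t : chart t != 0.
Proof.
have [x1 _ _] := xyz_chart t; apply/eqP => t0; move: x1; rewrite t0.
by rewrite -(scale0r e) xZ mul0r => /eqP; rewrite eq_sym oner_eq0.
Qed.

Let cts_chart : continuous chart.
Proof.
apply: cts_mx => i j; rewrite /chart; under eq_fun do rewrite !mxE.
apply: ctsD; [apply: ctsD|]; try (apply: ctsM); try exact: cts_cst.
  by apply: cts_fst; exact: cts_id.
by apply: cts_snd; exact: cts_id.
Qed.

Let pt t : RP2 := rp2_pt (chart_nz t).

Let pt_positive t : disc t -> positive_part S (pt t).
Proof.
move=> dt; rewrite /positive_part /= /pt; have [k k0 ->] := hcoord_rp2_pt (chart_nz t).
rewrite qformZl qformZr mulrA -expr2 mulr_gt0 ?exprn_even_gt0 //.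
by have [E1 E2 E3] := xyz_chart t; rewrite Q E1 E2 E3 expr1n subr_gt0.
Qed.

(** This is (y / x, z / x) on the positive part; the maximum in the denominator makes it
    continuous on the whole projective plane. *)
Let coord p : R * R :=
  let w := hcoord p in
  let m := Num.max (x w ^+ 2) (y w ^+ 2 + z w ^+ 2) in
  (x w * y w / m, x w * z w / m).

Let coord_positive p : positive_part S p ->
  let w := hcoord p in
  [/\ x w != 0, coord p = (y w / x w, z w / x w) & disc (coord p)].
Proof.
rewrite /positive_part /= Q subr_gt0 => lt.
have x2 : 0 < x (hcoord p) ^+ 2 by apply: le_lt_trans lt; rewrite addr_ge0 ?sqr_ge0.
have x0 : x (hcoord p) != 0 by apply: contraTneq x2 => ->; rewrite expr0n ltxx.
have E : coord p = (y (hcoord p) / x (hcoord p), z (hcoord p) / x (hcoord p)).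
  by rewrite /coord /= max_l ?ltW //; congr (_, _); field.
split=> //; rewrite E /disc /= !exprMn -mulrDl exprVn ltr_pdivrMr // mul1r.
exact: lt.
Qed.

Let coordK p : positive_part S p -> pt (coord p) = p.
Proof.
move=> /coord_positive[x0 E _]; apply: (@hcoord_point _ _ _ (x (hcoord p))^-1).
have {2}-> := xyz (hcoord p).
rewrite E /chart /= !scalerDr !scalerA mulVf // scale1r.
by congr (_ + _ *: _ + _ *: _); rewrite mulrC.
Qed.

Let ptK t : disc t -> coord (pt t) = t.
Proof.
move=> dt; have [x0 -> _] := coord_positive (pt_positive dt).
move: x0; rewrite /pt; have [k k0 ->] := hcoord_rp2_pt (chart_nz t).
have [E1 E2 E3] := xyz_chart t; rewrite xZ yZ zZ E1 E2 E3 mulr1 => _.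
by rewrite [RHS]surjective_pairing; congr (_, _); field.
Qed.

Let cts_coords : continuous coord.
Proof.
have cq w : continuous (fun w' => qform S w w').
  have -> : (fun w' => qform S w w') = fun w' => dot (w *m S) w'.
    by apply/funext => w'; rewrite /qform mx11_sum3 /dot !mxE.
  by apply: cts_dot; [exact: cts_cst|exact: cts_id].
have cx : continuous x by exact: cq.
have cy : continuous y by apply: ctsN; exact: cq.
have cz : continuous z by apply: ctsN; exact: cq.
pose m w := Num.max (x w ^+ 2) (y w ^+ 2 + z w ^+ 2).
have cm : continuous m by apply: cts_max; [|apply: ctsD]; apply: ctsX.
have m0 w : w != 0 -> m w != 0.
  move=> w0; rewrite lt0r_neq0 // /m lt_max; apply/orP.
  case: (eqVneq (x w) 0) => [x0|x0]; last by left; rewrite exprn_even_gt0.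
  right; case: (eqVneq (y w) 0) => [y0|y0]; last first.
    by apply: ltr_pwDl; [rewrite exprn_even_gt0|exact: sqr_ge0].
  rewrite y0 expr0n add0r exprn_even_gt0 //=; apply: contra w0 => /eqP z0.
  by rewrite (xyz w) x0 y0 z0 !scale0r !addr0.
have mZ k w : m (k *: w) = k ^+ 2 * m w.
  by rewrite /m xZ yZ zZ !exprMn -mulrDr maxr_pMr // sqr_ge0.
apply: cts_pair.
  apply: (@cts_ratio R (fun w => x w * y w) m) => //; first exact: ctsM.
  by move=> k w k0; rewrite mZ xZ yZ mulrACA -expr2 -mulf_div divff ?mul1r ?expf_neq0.
apply: (@cts_ratio R (fun w => x w * z w) m) => //; first exact: ctsM.
by move=> k w k0; rewrite mZ xZ zZ mulrACA -expr2 -mulf_div divff ?mul1r ?expf_neq0.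
Qed.

(** A positive point is joined to the centre by shrinking its affine coordinates. *)
Lemma positive_component p : 0 < qform S (hcoord p) (hcoord p) ->
  connected_component (~` zero_set S) p = positive_part S.
Proof.
move=> p0; apply/seteqP; split; first exact: component_positive.
have joined q : positive_part S q ->
    connected_component (~` zero_set S) (pt (0, 0)) q.
  move=> q0; have [_ _ dq] := coord_positive q0.
  pose B := range (fun t => pt (shrink t * (coord q).1, shrink t * (coord q).2)).
  apply: (@connected_component_max _ _ B).
  - by exists 0 => //; rewrite shrink0 !mul0r.
  - move=> _ [t _ <-]; have := pt_positive (shrink_disc t dq).
    by rewrite /positive_part /zero_set /= => + E; rewrite E ltxx.
  - apply: connected_continuous_connected.
      by apply/connected_intervalP => ? ? ? ? ? ?.
    apply: continuous_subspaceT; apply: cts_rp2_pt; apply: cts_comp; first exact: cts_chart.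
    by apply: cts_pair; apply: ctsM; try exact: cts_cst; exact: cts_shrink.
  by exists 1 => //; rewrite shrink1 !mul1r -surjective_pairing coordK.
by move=> q q0; rewrite -(same_connected_component (joined p p0)); exact: joined.
Qed.

Lemma positive_part_disc : homeomorphic (positive_part S) (disc (R := R)).
Proof.
have dc p : positive_part S p -> disc (coord p) by move=> /coord_positive[].
exists (fun p : positive_part S => SigSub (mem_set (dc _ (set_valP p)))).
exists (fun t : disc (R := R) => SigSub (mem_set (pt_positive (set_valP t)))).
split.
- apply: continuous_comp_initial.
  apply: (@cts_comp _ _ _ coord set_val); first exact: cts_coords.
  exact: initial_continuous.
- apply: continuous_comp_initial; apply: cts_rp2_pt.
  apply: (@cts_comp _ _ _ chart set_val); first exact: cts_chart.
  exact: initial_continuous.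
- by move=> p; apply/val_inj; exact: coordK (set_valP p).
- by move=> t; apply/val_inj; exact: ptK (set_valP t).
Qed.
End Hyperboloid.

Lemma inside_disc S p : 0 < qform S (hcoord p) (hcoord p) ->
  inside (zero_set S) p <->
  homeomorphic (connected_component (~` zero_set S) p) (disc (R := R)).
Proof.
move=> p0; split=> [[]//|H]; split=> //.
by rewrite /zero_set /= => E; rewrite E ltxx in p0.
Qed.

Lemma unit_scale S w : qform S w w != 0 ->
  exists2 k, k != 0 & qform S (k *: w) (k *: w) = Num.sg (qform S w w).
Proof.
set q := qform S w w => q0; have q0' : 0 < `|q| by rewrite normr_gt0.
exists (Num.sqrt `|q|)^-1; first by rewrite invr_eq0 sqrtr_eq0 -ltNge.
rewrite qformZl qformZr mulrA -invfM -expr2 sqr_sqrtr ?ltW // -/q.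
by rewrite {2}(numEsg q) mulrCA mulVf ?mulr1 ?normr_eq0.
Qed.

(** Changing the sign of S if necessary, let the form be positive at p.  In a frame of
    vectors orthogonal for S, the signature is (1, 2) if det S > 0, and the positive part is
    then a disc; if det S < 0 there is a positive plane through p, and the component of p
    contains a one-sided loop. *)
Lemma insideP S a b c p :
    S^T = S -> \det S != 0 -> br a b c != 0 ->
    qform S a a = 0 -> qform S b b = 0 -> qform S c c = 0 ->
  inside (zero_set S) p <-> 0 < qform S (hcoord p) (hcoord p) * \det S.
Proof.
wlog p0 : S / 0 < qform S (hcoord p) (hcoord p) => [H|].
  move=> symS dS abc qa qb qc.
  have [p0|p0|p0] := ltgtP (qform S (hcoord p) (hcoord p)) 0; last first.
  - by rewrite p0 mul0r ltxx; split=> // -[]; rewrite /zero_set /= p0.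
  - exact: H.
  have dN : \det (-1 *: S) = - \det S by rewrite detZ; ring.
  have := H (-1 *: S); rewrite dN !qform_scale qa qb qc mulr0 zero_setZ ?oppr_eq0 ?oner_eq0 //.
  rewrite !mulN1r mulrNN oppr_gt0 => -> //.
  by rewrite linearZ /= symS.
move=> symS dS abc qa qb qc; rewrite inside_disc // pmulr_rgt0 //.
have [u [v [[pu pv uv] [uu vv puv]]]] := polar_frame symS p0 dS abc qa qb qc.
have [dneg|dpos|d0] := ltgtP (\det S) 0; last by rewrite d0 eqxx in dS.
  by split=> // /(exterior_not_disc symS p0 _ pv); case; rewrite -(nmulr_llt0 _ dneg).
split=> // _; have vv' : qform S v v < 0 by rewrite -(pmulr_llt0 _ dpos).
have [k k0 E] := unit_scale (lt0r_neq0 p0); rewrite gtr0_sg // in E.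
have [l l0 Eu] := unit_scale (ltr0_neq0 uu); rewrite ltr0_sg // in Eu.
have [m m0 Ev] := unit_scale (ltr0_neq0 vv'); rewrite ltr0_sg // in Ev.
have nz : br (k *: hcoord p) (l *: u) (m *: v) != 0.
  have -> : br (k *: hcoord p) (l *: u) (m *: v) = k * l * m * br (hcoord p) u v.
    by rewrite /coords !mxE /=; ring.
  by rewrite !mulf_neq0.
have Epu : qform S (k *: hcoord p) (l *: u) = 0 by rewrite qformZl qformZr pu !mulr0.
have Epv : qform S (k *: hcoord p) (m *: v) = 0 by rewrite qformZl qformZr pv !mulr0.
have Euv : qform S (l *: u) (m *: v) = 0 by rewrite qformZl qformZr uv !mulr0.
rewrite (positive_component symS nz Epu Epv Euv E Eu Ev p0).
exact: positive_part_disc symS nz Epu Epv Euv E Eu Ev.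
Qed.
End InsideConic.

(** * The sixth point *)

Local Close Scope classical_set_scope.
Local Close Scope quotient_scope.

Section FivePoints.
Variable R : realType.
Notation br u v w := (bracket (coords u) (coords v) (coords w)).
Notation hex a b c d e f :=
  (hexad (coords a) (coords b) (coords c) (coords d) (coords e) (coords f)).

Lemma qform_eq0 (S : 'M[R]_3) : S^T = S -> (forall v, qform S v v = 0) -> S = 0.
Proof.
move=> symS q0; apply/matrixP => i j; rewrite [RHS]mxE.
have : 2 * qform S (delta_mx 0 i) (delta_mx 0 j) = 0.
  transitivity (qform S (delta_mx 0 i + delta_mx 0 j) (delta_mx 0 i + delta_mx 0 j)
     - qform S (delta_mx 0 i) (delta_mx 0 i) - qform S (delta_mx 0 j) (delta_mx 0 j)).
    by rewrite !(qformDl, qformDr) (qformC (delta_mx 0 j) _ symS); ring.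
  by rewrite !q0 !subr0.
move/eqP; rewrite mulf_eq0 pnatr_eq0 /= => /eqP <-.
by rewrite /qform -rowE trmx_delta -colE !mxE.
Qed.

Variables (x : 'I_8 -> RP2 R) (a : 'I_8 -> 'rV[R]_3) (s : 'I_8 -> R).
Hypothesis s_neq0 : forall i, s i != 0.
Hypothesis hcoord_x : forall i, hcoord (x i) = s i *: a i.

Lemma zero_set_x S i : zero_set S (x i) <-> qform S (a i) (a i) = 0.
Proof.
rewrite /zero_set /= hcoord_x qformZl qformZr; split=> [/eqP|->]; last by rewrite !mulr0.
by rewrite !mulf_eq0 (negPf (s_neq0 i)) => /eqP.
Qed.

Variables k1 k2 k3 k4 k5 : 'I_8.
Let K : {set 'I_8} := [set k in [:: k1; k2; k3; k4; k5]].
Let P := prod10 (a k1) (a k2) (a k3) (a k4) (a k5).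
Hypothesis P_neq0 : P != 0.

Lemma conic5_through : conic_through x K (zero_set (conic5 (a k1) (a k2) (a k3) (a k4) (a k5))).
Proof.
set S := conic5 _ _ _ _ _.
have symS : S^T = S by exact: conic5_sym.
split.
  exists S; split=> //; apply/eqP => S0; move: P_neq0.
  have [E _ _] := qform_conic5_offdiag (a k1) (a k2) (a k3) (a k4) (a k5).
  move: E; rewrite -/S S0 /P /prod10 /qform mulmx0 mul0mx mxE => /eqP.
  by rewrite eq_sym oppr_eq0 !mulf_eq0 => /orP[/orP[/orP[]|]|] ->; rewrite ?orbT.
move=> k; rewrite inE zero_set_x qform_conic5_diag => kK.
have [ha hb hc hd he] := hexad_repeat (coords (a k1)) (coords (a k2)) (coords (a k3))
  (coords (a k4)) (coords (a k5)).
by move: kK; rewrite !inE => /or4P[| | |/orP[|]] /eqP ->; rewrite ?(ha, hb, hc, hd, he) mulr0.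
Qed.

(** Whatever the matrix of the conic, its form is proportional to the hexad and its
    determinant is known. *)
Lemma conic_throughP C : conic_through x K C -> exists S t,
  [/\ S^T = S, t != 0 & C = zero_set S] /\
  [/\ forall v, qform S v v = 2 * t * hex (a k1) (a k2) (a k3) (a k4) (a k5) v,
      \det S = - 2 * t ^+ 3 * P & forall k, k \in K -> qform S (a k) (a k) = 0].
Proof.
move=> [[S [symS S0 ->]] CK].
have qK k : k \in K -> qform S (a k) (a k) = 0 by move=> /CK /(zero_set_x S k).
have [|t [qE dE]] := conic5_unique symS P_neq0.
  by split; apply: qK; rewrite !inE eqxx ?orbT.
exists S, t; split; split=> //; apply: contra_neq S0 => t0.
by apply: qform_eq0 => // v; rewrite qE t0 mulr0 mul0r.
Qed.

Lemma conic_through_sixth i :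
  (exists2 C, conic_through x K C & C (x i)) <->
  hex (a k1) (a k2) (a k3) (a k4) (a k5) (a i) = 0.
Proof.
split=> [[C /conic_throughP[S [t [[_ t0 ->] [qE _ _]]]]]|h0].
  by rewrite zero_set_x qE => /eqP; rewrite !mulf_eq0 (negPf t0) pnatr_eq0 => /eqP.
by exists (zero_set (conic5 (a k1) (a k2) (a k3) (a k4) (a k5)));
  [exact: conic5_through|rewrite zero_set_x qform_conic5_diag h0 mulr0].
Qed.

(** The form takes the value 2 t hexad at the sixth point and its determinant is
    - 2 t ^ 3 P: the sign of their product, which decides by [insideP], does not depend
    on t. *)
Lemma inside_conic5 i :
  (exists2 C, conic_through x K C & inside C (x i)) <->
  hex (a k1) (a k2) (a k3) (a k4) (a k5) (a i) * P < 0.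
Proof.
have main C : conic_through x K C ->
    inside C (x i) <-> hex (a k1) (a k2) (a k3) (a k4) (a k5) (a i) * P < 0.
  move=> /conic_throughP[S [t [[symS t0 ->] [qE dE qK]]]].
  have dS : \det S != 0.
    rewrite dE; apply: mulf_neq0 => //; apply: mulf_neq0; last exact: expf_neq0.
    by rewrite oppr_eq0 pnatr_eq0.
  have k123 : br (a k1) (a k2) (a k3) != 0.
    by apply: contraNneq P_neq0; rewrite /P /prod10 => ->; rewrite !mul0r.
  rewrite (insideP (x i) symS dS k123) ?qK ?inE ?eqxx ?orbT // hcoord_x qformZl qformZr qE dE.
  set h := hex _ _ _ _ _ _.
  have -> : s i * (s i * (2 * t * h)) * (- 2 * t ^+ 3 * P) = - ((2 * s i * t ^+ 2) ^+ 2 * (h * P)).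
    by ring.
  rewrite oppr_gt0 pmulr_rlt0 // exprn_even_gt0 //.
  by rewrite mulf_neq0 ?expf_neq0 // mulf_neq0 // pnatr_eq0.
split=> [[C CK]|hP]; first by rewrite main.
exists (zero_set (conic5 (a k1) (a k2) (a k3) (a k4) (a k5))); first exact: conic5_through.
by rewrite main //; exact: conic5_through.
Qed.
End FivePoints.

(** * Brackets of a convex octagon *)

(** The sides [i, i+1] and [i+1, i+2] both see the triangle i, i+1, i+2, so consecutive
    triangles have the same sign, and so have all triangles with a side [i, i+1].  The
    relation with pivot i propagates the sign to the other triangles. *)
Lemma convex_chain (T : realDomainType) (N : nat) (p : nat -> T * T * T) :
    (forall i j k, (i.+1 < N)%N -> (j < N)%N -> (k < N)%N ->
       j \notin [:: i; i.+1] -> k \notin [:: i; i.+1] ->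
       0 < bracket (p i) (p i.+1) (p j) * bracket (p i) (p i.+1) (p k)) ->
  let e := bracket (p 0%N) (p 1%N) (p 2%N) in
  forall i j k, (i < j < k)%N -> (k < N)%N -> 0 < e * bracket (p i) (p j) (p k).
Proof.
move=> side e i j k /andP[ij jk] kN.
have trans x y z : 0 < x * y -> 0 < y * z -> 0 < x * z :> T.
  move=> xy yz; have y0 : 0 < y ^+ 2.
    by rewrite exprn_even_gt0 //; apply: contraTneq xy => ->; rewrite mulr0 ltxx.
  have E : x * z * y ^+ 2 = (x * y) * (y * z) by ring.
  rewrite -(pmulr_lgt0 _ y0) E.
  exact: mulr_gt0.
have consecutive n : (n.+2 < N)%N -> 0 < e * bracket (p n) (p n.+1) (p n.+2).
  elim: n => [|n IHn] nN; first by apply: side => //; rewrite ?inE; lia.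
  apply: (trans _ (bracket (p n) (p n.+1) (p n.+2))); first by apply: IHn; lia.
  rewrite -[X in X * _]bracket_cycle; apply: side; rewrite ?inE; lia.
have edge n m : (n.+1 < N)%N -> (m < N)%N -> m \notin [:: n; n.+1] ->
    0 < e * bracket (p n) (p n.+1) (p m).
  move=> nN mN; rewrite !inE => nm; case: (ltnP n.+2 N) => [n2|n2].
    apply: (trans _ _ _ (consecutive n n2)); apply: side; rewrite ?inE; lia.
  case: n nN nm n2 => [|n] nN nm n2.
    lia.
  apply: (trans _ _ _ (consecutive n nN)).
  rewrite -[X in X * _]bracket_cycle; apply: side; rewrite ?inE; lia.
elim: k jk kN => // k IHk; rewrite ltnS leq_eqVlt => /orP[/eqP <-|jk] kN.
  rewrite -bracket_cycle; apply: edge; rewrite ?inE; lia.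
case: (eqVneq j i.+1) => [->|ji]; first by apply: edge; rewrite ?inE; lia.
have ik : 0 < e * bracket (p i) (p i.+1) (p k) by apply: edge; rewrite ?inE; lia.
rewrite -(pmulr_lgt0 _ ik).
have P := plucker_fst (p i) (p i.+1) (p j) (p k) (p k.+1).
have -> : e * bracket (p i) (p j) (p k.+1) * (e * bracket (p i) (p i.+1) (p k)) =
  (e * bracket (p i) (p i.+1) (p j)) * (e * bracket (p i) (p k) (p k.+1)) +
  (e * bracket (p i) (p i.+1) (p k.+1)) * (e * bracket (p i) (p j) (p k)).
  transitivity (e ^+ 2 * (bracket (p i) (p i.+1) (p j) * bracket (p i) (p k) (p k.+1) +
     bracket (p i) (p i.+1) (p k.+1) * bracket (p i) (p j) (p k)) - e ^+ 2 * 0).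
    by rewrite -P; ring.
  by ring.
apply: addr_gt0; apply: mulr_gt0.
- apply: edge; rewrite ?inE; lia.
- rewrite -bracket_cycle; apply: edge; rewrite ?inE; lia.
- apply: edge; rewrite ?inE; lia.
- apply: IHk => //; lia.
Qed.

Section ConvexPosition.
Variable R : realType.
Notation br u v w := (bracket (coords u) (coords v) (coords w)).

Lemma ord8_succ n : (n.+1 < 8)%N -> (inord n : 'I_8) + 1 = inord n.+1.
Proof.
move=> n8; apply: val_inj; rewrite /= !inordK //; last exact: ltnW.
by rewrite (modn_small (isT : (1 < 8)%N)) addn1 modn_small.
Qed.

(** The common sign of the brackets is absorbed by the representatives, as a bracket has odd
    degree. *)
Lemma convex_position_frame (x : 'I_8 -> RP2 R) : convex_position x ->
  exists a s, [/\ forall i, s i != 0, forall i, hcoord (x i) = s i *: a i &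
    forall i j k : 'I_8, (i < j < k)%N -> 0 < br (a i) (a j) (a k)].
Proof.
move=> [l _ [lx cvx]]; pose b i := affine_pt l (x i).
pose p n := coords (b (inord n)).
have side i j k : (i.+1 < 8)%N -> (j < 8)%N -> (k < 8)%N ->
    j \notin [:: i; i.+1] -> k \notin [:: i; i.+1] ->
    0 < bracket (p i) (p i.+1) (p j) * bracket (p i) (p i.+1) (p k).
  move=> i8 j8 k8 ji ki; have out m : (m < 8)%N -> m \notin [:: i; i.+1] ->
      (inord m : 'I_8) \notin [:: inord i; inord i + 1].
    by move=> m8; rewrite ord8_succ // !inE -!(inj_eq val_inj) /= !inordK // ltnW.
  have := cvx (inord i) (inord j) (inord k) (out j j8 ji) (out k k8 ki).
  by rewrite /same_side !orientE ord8_succ.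
pose e := bracket (p 0%N) (p 1%N) (p 2%N).
have pos := convex_chain side; rewrite -/e in pos.
have e0 : e != 0 by have := pos 0%N 1%N 2%N isT isT; apply: contraTneq => ->; rewrite mul0r ltxx.
exists (fun i => e *: b i), (fun i => (hcoord (x i) *m l) 0 0 / e); split.
- by move=> i; rewrite mulf_neq0 ?invr_eq0.
- by move=> i; rewrite scalerA divfK // /b /affine_pt scalerA divff // scale1r.
move=> i j k ijk; have := pos i j k ijk (ltn_ord k); rewrite /p !inord_val => pijk.
have -> : br (e *: b i) (e *: b j) (e *: b k) =
          e ^+ 2 * (e * br (b i) (b j) (b k)) by rewrite /coords !mxE /=; ring.
by rewrite mulr_gt0 // exprn_even_gt0.
Qed.
End ConvexPosition.

(** * Alternating functions of labels *)

Section Alternating.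
Variable R : realDomainType.

(** The parity of the number of inversions. *)
Fixpoint odd_inv (s : seq nat) : bool :=
  if s is x :: s' then odd (count (fun y => (y < x)%N) s') (+) odd_inv s' else false.

Variables (n : nat) (F : seq nat -> R).
Hypothesis F_swap : forall u x y v, size (u ++ x :: y :: v) = n ->
  F (u ++ x :: y :: v) = - F (u ++ y :: x :: v).

Let move_right u x v w : size (u ++ x :: v ++ w) = n ->
  F (u ++ x :: v ++ w) = (-1) ^+ size v * F (u ++ v ++ x :: w).
Proof.
elim: v u => [|y v IHv] u Hn; first by rewrite /= mul1r.
rewrite /= F_swap // -cat_rcons IHv; last by move: Hn; rewrite !size_cat /= size_rcons; lia.
by rewrite cat_rcons exprS mulN1r mulNr.
Qed.

Let sort_split x s :
  sort leq s = [seq y <- sort leq s | (y < x)%N] ++ [seq y <- sort leq s | (x <= y)%N].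
Proof.
have ss := sort_sorted leq_total s.
apply: (sorted_eq leq_trans anti_leq) => //.
  rewrite sorted_pairwise; last exact: leq_trans.
  rewrite pairwise_cat -!sorted_pairwise; try exact: leq_trans.
  rewrite !(sorted_filter leq_trans) // !andbT.
  apply/allrelP => y z; rewrite !mem_filter => /andP[yx _] /andP[xz _].
  exact: ltnW (leq_trans yx xz).
rewrite perm_sym -(eq_filter (fun y => esym (leqNgt x y))).
exact/permPl/perm_filterC.
Qed.

Let sort_sign u s : size (u ++ s) = n ->
  F (u ++ s) = (-1) ^+ odd_inv s * F (u ++ sort leq s).
Proof.
elim: s u => [|x s IHs] u Hn; first by rewrite mul1r.
rewrite -cat_rcons IHs; last by rewrite -Hn !size_cat size_rcons /=; lia.
rewrite cat_rcons {1}(sort_split x s) move_right; last first.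
  by rewrite -sort_split -Hn !size_cat /= size_sort.
rewrite /= signr_addb signr_odd mulrCA mulrA; congr (_ ^+ _ * _ * F (_ ++ _)).
  by rewrite size_filter; apply/seq.permP; rewrite perm_sort.
apply: (sorted_eq leq_trans anti_leq).
- have ss := sort_sorted leq_total s.
  rewrite sorted_pairwise; last exact: leq_trans.
  rewrite pairwise_cat /= -!sorted_pairwise; try exact: leq_trans.
  rewrite !(sorted_filter leq_trans) // !andbT; apply/andP; split; last first.
    by apply/allP => b; rewrite mem_filter => /andP[].
  apply/allrelP => a b; rewrite mem_filter => /andP[ax _].
  rewrite inE mem_filter => /orP[/eqP->|/andP[xb _]]; first exact: ltnW.
  exact: ltnW (leq_trans ax xb).
- exact: sort_sorted leq_total _.
- rewrite perm_sym perm_sort -cat1s perm_sym -[x :: seq.filter _ _]cat1s perm_catCA.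
  by rewrite perm_cat2l -sort_split perm_sort.
Qed.

(** Insertion sort, one transposition of neighbours at a time. *)
Lemma alternating_sort s : size s = n ->
  F s = (-1) ^+ odd_inv s * F (sort leq s).
Proof. exact: (@sort_sign [::]). Qed.
End Alternating.

(** * Codes and their symmetries *)

Local Close Scope ring_scope.

Fixpoint sublists (k : nat) (s : seq nat) : seq (seq nat) :=
  if s is x :: s' then
    if k is k'.+1 then [seq x :: t | t <- sublists k' s'] ++ sublists k s' else [:: [::]]
  else if k is 0 then [:: [::]] else [::].

Definition labels := iota 0 8.
Definition fives := sublists 5 labels.
Definition sixes := sublists 6 labels.

(** The place in a code of the sign for the labels w, and the parity of the permutation that
    sorts them. *)
Definition address (w : seq nat) : nat * bool := (index (sort leq w) sixes, odd_inv w).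
Definition read_bit (c : seq bool) (a : nat * bool) : bool := nth false c a.1 (+) a.2.
(** True stands for a negative hexad of the labels w, in this order. *)
Definition chi c w := read_bit c (address w).

(** Hexads are alternating, so that their signs on sorted labels determine all of them. *)
Definition code_at (R : realDomainType) (p : nat -> R * R * R) : seq bool :=
  [seq (hexad_at p w < 0)%R | w <- sixes].

Definition term : Type := seq nat * bool.
(** The sign of a product of hexads, changed if b is true, in terms of the bits of a code. *)
Definition mkterm (ws : seq (seq nat)) (b : bool) : term :=
  ([seq (address w).1 | w <- ws], foldr addb b [seq (address w).2 | w <- ws]).
Definition eval_term (c : seq bool) (t : term) : bool := foldr addb t.2 [seq nth false c n | n <- t.1].

Definition constr : Type := term * term * term.
(** Terms with sum zero do not all have the same sign. *)
Definition satisfies c (q : constr) : bool :=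
  let: (x, y, z) := q in ~~ ((eval_term c x == eval_term c y) && (eval_term c y == eval_term c z)).

Definition remaining (s : seq nat) := [seq i <- labels | i \notin s].

(** The sign conditions imposed by [hexad_gp]. *)
Definition gp_constraints : seq constr :=
  [seq (let r := remaining t in let i := nth 0 r in
    (mkterm [:: t ++ [:: i 0; i 1]; t ++ [:: i 2; i 3]] false,
     mkterm [:: t ++ [:: i 0; i 2]; t ++ [:: i 1; i 3]] true,
     mkterm [:: t ++ [:: i 0; i 3]; t ++ [:: i 1; i 2]] false)) | t <- sublists 4 labels].

Definition pairings (t : seq nat) :=
  if t is [:: a; b; c; d] then [:: [:: a; b; c; d]; [:: a; c; b; d]; [:: a; d; b; c]] else [::].

(** The sign condition imposed by [hexad_pencil]: in convex position sg m is the sign of the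
    value at m of the line pair that joins the first two and the last two labels of t. *)
Definition pencil_constraint (t : seq nat) (u : seq nat) : constr :=
  let sg m := odd_inv [:: nth 0 t 0; nth 0 t 1; m] (+) odd_inv [:: nth 0 t 2; nth 0 t 3; m] in
  let i := nth 0 u in
  (mkterm [:: t ++ [:: i 1; i 2]] (sg (i 0)),
   mkterm [:: t ++ [:: i 0; i 2]] (~~ sg (i 1)),
   mkterm [:: t ++ [:: i 0; i 1]] (sg (i 2))).

Definition pencil_constraints : seq constr :=
  flatten [seq [seq pencil_constraint t' u | t' <- pairings t, u <- sublists 3 (remaining t)]
          | t <- sublists 4 labels].

Definition constraints := gp_constraints ++ pencil_constraints.

Definition depth (q : constr) : nat :=
  let: (x, y, z) := q in foldr maxn 0 (x.1 ++ y.1 ++ z.1).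

(** Codes are extended bit by bit, and a constraint is tested once the last of its bits is
    known. *)
Fixpoint search (n : nat) : seq (seq bool) :=
  if n is m.+1 then
    let qs := [seq q <- constraints | depth q == m] in
    [seq p <- [seq rcons p b | p <- search m, b <- [:: true; false]] | all (satisfies p) qs]
  else [:: [::]].

Definition codes := search 28.

(** The inverse of [rotation k] on the values of labels; [reflect_label] is that of [reflection k]. *)
Definition rotate_label (k i : nat) := (i + (8 - k)) %% 8.
Definition reflect_label (k i : nat) := (k + (8 - i)) %% 8.
(** The last label is a point, the five others span a conic: the label of the point stays
    last.  Sorting all six would lose a sign, as a reflection preserves the inside of a conic
    but not the sign of a hexad. *)
Definition act_word (f : nat -> nat) (w : seq nat) :=
  rcons (sort leq (map f (take 5 w))) (f (nth 0 w 5)).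
Definition act_table f := [seq address (act_word f w) | w <- sixes].
Definition act_code f c := [seq read_bit c a | a <- act_table f].

(** A code has one bit for each set of six labels, while a list has an entry for each choice
    of the point among the six; relabelling by f must treat all choices alike. *)
Definition compatible f :=
  all (fun K => all (fun i => (i \in K) ||
    (let w := rcons K i in let w' := nth [::] sixes (address w).1 in
     let a := address (act_word f w') in let b := address (act_word f w) in
    (a.1 == b.1) && (a.2 (+) odd_inv w == b.2))) labels) fives.

(** The entries that compare the labels i and i + 1, for the six conics that avoid both. *)
Definition sep_table (i : nat) :=
  let j := (i + 1) %% 8 in
  [seq (address (rcons K i), address (rcons K j)) | K <- fives & (i \notin K) && (j \notin K)].
Definition oct_entry c (tab : seq ((nat * bool) * (nat * bool))) : int :=
  let sep := [seq ab <- [seq (read_bit c ab.1, read_bit c ab.2) | ab <- tab] | ab.1 != ab.2] in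
  if all (fun ab => ~~ ab.1 && ab.2) sep then (- Posz (size sep))%R else Posz (size sep).
Definition sep_tables := [seq sep_table i | i <- labels].
Definition oct c : seq int := [seq oct_entry c tab | tab <- sep_tables].
Definition oct_sum (t : seq int) : int := foldr +%R 0%R t.

Definition rot_oct k (t : seq int) := [seq nth 0%R t ((i + k) %% 8) | i <- labels].
Definition refl_oct k (t : seq int) := [seq (- nth 0 t ((k + (8 - i)) %% 8))%R | i <- labels].
Definition oct_equiv (t u : seq int) :=
  has (fun k => (u == rot_oct k t) || (u == refl_oct k t)) labels.
Definition ambiguous (t : seq int) :=
  oct_equiv t [:: 3; 0; 0; 0; -3; 0; 0; 0]%R || oct_equiv t [:: 1; 0; -1; 1; -1; 0; 1; -1]%R.

(** Unlike a conjunction evaluated by value, this stops at the first difference. *)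
Fixpoint eqbits (s t : seq bool) : bool :=
  match s, t with
  | [::], [::] => true
  | b :: s', b' :: t' => if (if b then b' else ~~ b') then eqbits s' t' else false
  | _, _ => false
  end.
Definition bits_in c (cs : seq (seq bool)) := has (eqbits c) cs.
(** A key that is cheap to compare: different keys come from different octuples. *)
Definition Z_of_oct (t : seq int) : Z := foldr (fun n acc => Z.add (Z_of_int n) (Z.mul 16 acc)) Z0 t.
Definition octs := [seq (c, oct c) | c <- codes].

(** One convex octagon for each of the 47 orbits, found by sampling integer points near a
    circle. *)
Definition configurations : seq (seq (int * int)) :=
  [::
   [:: (9, 4); (6, 8); (3, 9); (-8, 6); (-9, -5); (-4, -9); (4, -9); (9, -5)];
   [:: (9, 2); (-4, 9); (-5, 9); (-7, 7); (-9, 4); (-9, -4); (-5, -9); (5, -9)];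
   [:: (8, 6); (7, 7); (3, 9); (-7, 7); (-9, -4); (-7, -7); (-3, -9); (5, -8)];
   [:: (8, 7); (6, 8); (-8, 6); (-8, -6); (-6, -8); (6, -8); (7, -7); (8, -5)];
   [:: (9, 5); (-7, 7); (-8, 6); (-9, -3); (-9, -5); (-6, -8); (-4, -9); (6, -8)];
   [:: (7, 7); (4, 8); (-9, -1); (-9, -4); (-5, -8); (6, -7); (9, -4); (9, 0)];
   [:: (3, 9); (-6, 8); (-8, 6); (-9, -2); (-9, -3); (-7, -7); (-1, -9); (9, -5)];
   [:: (9, 3); (7, 7); (5, 8); (-8, 4); (-9, 1); (5, -8); (6, -8); (9, -7)];
   [:: (0, 9); (-6, 8); (-9, 2); (-8, -6); (-7, -7); (0, -9); (5, -9); (6, -8)];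
   [:: (9, 5); (7, 7); (-3, 9); (-9, -5); (-8, -6); (-4, -9); (6, -8); (7, -7)];
   [:: (6, 8); (-7, 7); (-9, -3); (-9, -5); (-5, -9); (8, -7); (9, -5); (9, -3)];
   [:: (8, 5); (8, 6); (5, 8); (-4, 9); (-6, 8); (-7, 7); (-8, -6); (-5, -9)];
   [:: (9, 3); (-9, -3); (-8, -6); (-6, -8); (-3, -9); (4, -9); (8, -6); (9, -4)];
   [:: (8, 6); (5, 8); (3, 9); (-5, 9); (-9, -4); (-6, -8); (4, -9); (6, -8)];
   [:: (7, 7); (-4, 9); (-6, 8); (-7, 7); (-9, 4); (-9, -5); (-7, -7); (9, -5)];
   [:: (9, 3); (8, 5); (6, 7); (-2, 9); (-7, 7); (-9, -2); (-7, -6); (0, -9)];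
   [:: (8, 6); (4, 9); (0, 9); (-6, 7); (-9, 5); (-7, -7); (1, -9); (9, -2)];
   [:: (8, 6); (-4, 9); (-7, 7); (-9, 4); (-6, -7); (-5, -9); (5, -9); (8, -6)];
   [:: (5, 7); (-5, 8); (-8, 5); (-7, -5); (-5, -7); (2, -8); (3, -8); (7, -7)];
   [:: (9, 2); (9, 5); (2, 8); (-1, 9); (-9, 5); (-9, -4); (-8, -6); (7, -7)];
   [:: (9, 4); (8, 6); (1, 9); (-6, 7); (-9, 1); (-5, -8); (6, -8); (7, -7)];
   [:: (7, 7); (3, 9); (-7, 7); (-9, 5); (-9, -4); (-6, -8); (8, -6); (8, -5)];
   [:: (9, 3); (9, 4); (8, 6); (-9, -3); (-9, -4); (-6, -8); (-5, -9); (7, -7)];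
   [:: (9, 4); (7, 7); (-6, 8); (-9, 5); (-9, -5); (-6, -8); (6, -8); (8, -6)];
   [:: (8, 6); (7, 7); (-7, 7); (-9, 5); (-9, 3); (-8, -5); (-7, -8); (-5, -9)];
   [:: (7, 7); (6, 8); (4, 9); (-5, 9); (-9, 4); (-9, -3); (-8, -6); (9, -3)];
   [:: (9, 3); (-4, 9); (-8, 7); (-9, 5); (-9, -4); (-8, -6); (-5, -9); (5, -8)];
   [:: (9, 3); (7, 6); (-4, 9); (-7, 7); (-9, -4); (-7, -8); (-4, -9); (9, -5)];
   [:: (7, 5); (6, 9); (-5, 9); (-7, -6); (-7, -7); (-4, -9); (-3, -9); (7, -7)];
   [:: (7, 7); (-4, 9); (-5, 9); (-7, 8); (-7, 7); (-3, -9); (8, -7); (8, -5)];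
   [:: (9, 1); (9, 3); (5, 9); (-4, 8); (-9, 5); (-8, -5); (6, -8); (8, -4)];
   [:: (8, 6); (-3, 9); (-9, -4); (-9, -5); (-7, -7); (6, -8); (7, -8); (9, -4)];
   [:: (5, 8); (4, 9); (-8, 4); (-6, -7); (-1, -9); (4, -9); (7, -6); (8, -2)];
   [:: (8, 5); (-9, 3); (-9, -5); (-7, -7); (-4, -9); (6, -8); (9, -5); (9, -4)];
   [:: (9, 4); (4, 9); (-6, 8); (-7, 7); (-6, -8); (-4, -9); (5, -9); (8, -6)];
   [:: (9, 1); (6, 7); (4, 9); (-1, 9); (-7, 7); (-7, -6); (7, -8); (9, 0)];
   [:: (8, 6); (-5, 8); (-6, 8); (-9, -3); (-6, -8); (0, -9); (7, -8); (8, -6)];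
   [:: (9, 2); (8, 4); (4, 9); (-6, 8); (-9, 5); (-9, 4); (-2, -9); (6, -9)];
   [:: (9, 2); (9, 5); (5, 8); (-2, 9); (-7, 6); (-9, 4); (-6, -9); (7, -6)];
   [:: (9, 3); (8, 7); (4, 9); (-4, 9); (-6, 8); (-9, -5); (-8, -6); (6, -8)];
   [:: (6, 8); (5, 9); (-5, 9); (-9, -2); (-8, -5); (-7, -7); (7, -7); (9, -4)];
   [:: (8, 6); (4, 9); (-5, 9); (-9, 5); (-6, -8); (-3, -9); (6, -8); (7, -7)];
   [:: (8, 6); (4, 9); (-4, 9); (-9, 4); (-4, -9); (4, -9); (6, -8); (8, -5)];
   [:: (8, 6); (-7, 7); (-8, 6); (-7, -7); (-5, -9); (6, -8); (9, -5); (9, -4)];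
   [:: (9, 1); (7, 6); (-4, 9); (-7, 7); (-8, 4); (-9, 0); (-6, -8); (8, -7)];
   [:: (8, 7); (6, 8); (-3, 9); (-4, 9); (-8, 6); (-9, -5); (-6, -8); (8, -7)];
   [:: (3, 9); (1, 9); (-8, 7); (-9, -6); (-1, -8); (6, -7); (7, -6); (8, -2)]
  ]%Z.

(** The mirror image restores the positive orientation of the reversed octagon. *)
Definition symmetric_images (P : seq (int * int)) :=
  [seq rot k P | k <- labels] ++ [seq rot k (rev [seq (- xy.1, xy.2)%R | xy <- P]) | k <- labels].

Definition config_point (P : seq (int * int)) (i : nat) : Z * Z * Z :=
  let: (x, y) := nth (0, 0)%R P i in (Z_of_int x, Z_of_int y, 1%R).
Definition convexZ (p : nat -> Z * Z * Z) : bool :=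
  all (fun w => (0 < bracket_at p w)%R) (sublists 3 labels).
Definition genericZ (p : nat -> Z * Z * Z) : bool := all (fun w => hexad_at p w != 0%R) sixes.
Definition images := flatten [seq symmetric_images P | P <- configurations].

(** Codes of one list in each orbit with a given absolute value of sigma. *)
Definition reps (m : nat) : seq (seq bool) :=
  [seq c <- [seq code_at (config_point P) | P <- configurations] | absz (oct_sum (oct c)) == m].

Definition levels := [:: 0; 2; 4; 6; 8].

Definition dihedral_images (c : seq bool) : seq (seq bool) :=
  [seq act_code (rotate_label k) c | k <- labels] ++
  [seq act_code (reflect_label k) c | k <- labels].

Definition rep_table : seq (nat * seq (seq bool)) :=
  [seq (m, flatten [seq dihedral_images c | c <- reps m]) | m <- levels].

(** * Computations on the codes *)

Lemma dihedral_compatible :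
  all (fun k => compatible (rotate_label k) && compatible (reflect_label k)) labels.
Proof. by vm_compute. Qed.

Lemma codes_closed : all (fun c => bits_in (act_code (rotate_label 1) c) codes &&
                                   bits_in (act_code (reflect_label 0) c) codes) codes.
Proof. by vm_compute. Qed.

Lemma octs_bounded : all (fun ct => all (fun i => (-6 <= nth 0 ct.2 i <= 6)%R) labels) octs.
Proof. by vm_compute. Qed.

Lemma octs_determine :
  let keyed := [seq (ct, Z_of_oct ct.2) | ct <- octs] in
  all (fun x => all (fun y =>
    if Z.eqb x.2 y.2 then if eqbits x.1.1 y.1.1 then true else
      ambiguous x.1.2 && has (fun k => eqbits y.1.1 (act_code (reflect_label k) x.1.1)) labels
    else true) keyed) keyed.
Proof. by vm_compute. Qed.

(** A reflection carries the side from i to i + 1 to the side from k - i - 1 to k - i, run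
    backwards: whence k + 7, which is k - 1 modulo 8. *)
Lemma octs_equivariant : all (fun k =>
  let t1 := act_table (rotate_label k) in let t2 := act_table (reflect_label k) in
  all (fun ct => (oct [seq read_bit ct.1 a | a <- t1] == rot_oct (8 - k) ct.2) &&
     (oct [seq read_bit ct.1 a | a <- t2] == refl_oct (k + 7) ct.2)) octs) labels.
Proof. by vm_compute. Qed.

Lemma images_convex : all (fun P => convexZ (config_point P) && genericZ (config_point P)) images.
Proof. by vm_compute. Qed.

Lemma images_realize : let cs := [seq code_at (config_point P) | P <- images] in
  all (fun c => bits_in c cs) codes.
Proof. by vm_compute. Qed.

Lemma reps_codes : all (fun c => bits_in c codes) (flatten [seq reps m | m <- levels]).
Proof. by vm_compute. Qed.

Lemma reps_cover : all (fun ct => has (fun ml =>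
  if absz (oct_sum ct.2) == ml.1 then bits_in ct.1 ml.2 else false) rep_table) octs.
Proof. by vm_compute. Qed.

Lemma reps_inequiv :
  all (fun m => pairwise (fun c d => ~~ oct_equiv (oct c) (oct d)) (reps m)) levels.
Proof. by vm_compute. Qed.

Lemma reps_size : [seq size (reps m) | m <- levels] = [:: 14; 12; 16; 4; 1].
Proof. by vm_compute. Qed.

Lemma reps_inhabited : all (fun m => size (reps m) != 0) levels.
Proof. by vm_compute. Qed.

(** * Sets of labels as words *)

Lemma mem_labels n : (n \in labels) = (n < 8).
Proof. by rewrite mem_iota. Qed.

Lemma labels_sorted : sorted ltn labels.
Proof. exact: iota_ltn_sorted. Qed.

Lemma mem_sublists k s t : (t \in sublists k s) = subseq t s && (size t == k).
Proof.
elim: s k t => [|x s IHs] [|k] [|y t] //=; rewrite ?inE ?andbF //.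
- by rewrite mem_cat IHs andbF orbF; apply/mapP => -[].
- rewrite mem_cat IHs -[(size t).+1 == _]/(size t == k).
  have -> : (y :: t \in [seq x :: u | u <- sublists k s]) = (y == x) && (t \in sublists k s).
    apply/mapP/andP => [[u us [-> ->]]|[/eqP -> ts]]; first by rewrite eqxx.
    by exists t.
  rewrite IHs; case: eqP => [->|_] //=; rewrite orb_idr // => /andP[st ->].
  by rewrite (subseq_trans (subseq_cons t x)).
Qed.

Lemma mem_sublists_labels k w :
  (w \in sublists k labels) = [&& sorted ltn w, all (fun n => n < 8) w & size w == k].
Proof.
rewrite mem_sublists andbA; congr (_ && _); apply/idP/andP => [sw|[sw lw]].
  split; first by apply: (subseq_sorted ltn_trans sw); exact: labels_sorted.
  by apply/allP => n /(mem_subseq sw); rewrite mem_labels.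
suff -> : w = [seq n <- labels | n \in w] by exact: filter_subseq.
apply: (irr_sorted_eq ltn_trans ltnn) => //.
  by apply: (sorted_filter ltn_trans); exact: labels_sorted.
by move=> n; rewrite mem_filter mem_labels andb_idr // => /(allP lw).
Qed.

Definition word (K : {set 'I_8}) : seq nat := [seq n <- labels | (inord n : 'I_8) \in K].
Definition word_set (w : seq nat) : {set 'I_8} := [set i | val i \in w].

Lemma mem_word K (i : 'I_8) : (val i \in word K) = (i \in K).
Proof. by rewrite mem_filter /= inord_val mem_labels ltn_ord andbT. Qed.

Lemma word_setK K : word_set (word K) = K.
Proof. by apply/setP => i; rewrite inE mem_word. Qed.

Lemma word_sorted K : sorted ltn (word K).
Proof. by apply: (sorted_filter ltn_trans); exact: labels_sorted. Qed.

Lemma word_lt8 K : all (fun n => n < 8) (word K).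
Proof. by apply/allP => n; rewrite mem_filter mem_labels => /andP[]. Qed.

Lemma size_word K : size (word K) = #|K|.
Proof.
rewrite -[K in RHS]word_setK cardE /word_set.
rewrite -(size_map val); apply/perm_size/uniq_perm.
- exact: (sorted_uniq ltn_trans ltnn (word_sorted K)).
- by rewrite map_inj_uniq ?enum_uniq //; exact: val_inj.
move=> n; apply/idP/mapP => [nK|[i + ->]]; last by rewrite mem_enum inE.
have n8 := allP (word_lt8 K) n nK.
by exists (Ordinal n8) => //; rewrite mem_enum inE.
Qed.

Lemma wordK k w : w \in sublists k labels -> word (word_set w) = w.
Proof.
rewrite mem_sublists_labels => /and3P[sw lw _].
apply: (irr_sorted_eq ltn_trans ltnn) => //; first exact: word_sorted.
move=> n; rewrite mem_filter mem_labels inE.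
case: (ltnP n 8) => n8; first by rewrite /= inordK // andbT.
by rewrite andbF; apply/esym/negP => /(allP lw); rewrite ltnNge n8.
Qed.

Lemma word_five (K : {set 'I_8}) : #|K| = 5 -> word K \in fives.
Proof. by move=> K5; rewrite mem_sublists_labels word_sorted word_lt8 size_word K5. Qed.

Lemma fives_uniq : uniq fives.
Proof. by vm_compute. Qed.

Lemma card_words (P : pred (seq nat)) :
  #|[set K : {set 'I_8} | (#|K| == 5) && P (word K)]| = count P fives.
Proof.
rewrite -size_filter -(size_map word_set).
have inj : {in fives &, injective word_set}.
  by move=> u v /wordK {2}<- /wordK {2}<- ->.
rewrite -(card_uniqP _); last first.
  rewrite map_inj_in_uniq ?filter_uniq ?fives_uniq // => u v.
  by rewrite !mem_filter => /andP[_ u5] /andP[_ v5]; exact: inj.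
apply: eq_card => K; rewrite inE; apply/andP/mapP => [[/eqP K5 PK]|[w + ->]].
  by exists (word K); rewrite ?word_setK // mem_filter PK word_five.
rewrite mem_filter => /andP[Pw w5]; rewrite (wordK w5) Pw -size_word (wordK w5).
by move: w5; rewrite mem_sublists_labels => /and3P[].
Qed.

(** A true bit of [chi] is a negative hexad, and with sorted labels it means inside. *)
Definition list_of_code (c : seq bool) : eight_list :=
  [ffun Ki : {set 'I_8} * 'I_8 =>
     [&& #|Ki.1| == 5, Ki.2 \notin Ki.1 & chi c (rcons (word Ki.1) (val Ki.2))]].

Lemma list_of_codeE c (K : {set 'I_8}) i : #|K| = 5 -> i \notin K ->
  list_of_code c (K, i) = chi c (rcons (word K) i).
Proof. by move=> K5 iK; rewrite ffunE /= K5 iK. Qed.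

(** The bit stored for a set of six labels was computed with the greatest one as the point;
    compatibility extends it to the other choices. *)
Lemma chi_act f c w i : compatible f -> w \in fives -> i < 8 -> i \notin w ->
  chi (act_code f c) (rcons w i) = chi c (rcons (sort leq (map f w)) (f i)).
Proof.
move=> cf w5 i8 iw.
have := allP (allP cf w w5) i; rewrite mem_labels i8 => /(_ isT).
rewrite (negPf iw) orFb => /andP[/eqP a1 /eqP a2].
have [sw lw /eqP zw] : [/\ sorted ltn w, all (fun n => n < 8) w & size w == 5].
  by apply/and3P; rewrite -mem_sublists_labels.
have six : sort leq (rcons w i) \in sixes.
  rewrite mem_sublists_labels size_sort size_rcons zw eqxx andbT.
  rewrite ltn_sorted_uniq_leq sort_uniq rcons_uniq iw (sorted_uniq ltn_trans ltnn sw).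
  by rewrite (sort_sorted leq_total) all_sort all_rcons i8.
have -> : rcons (sort leq (map f w)) (f i) = act_word f (rcons w i).
  by case: w zw {w5 iw sw lw six a1 a2} => [|? [|? [|? [|? [|? [|? ?]]]]]].
rewrite /chi [RHS]/read_bit -a1 -a2 [LHS]/read_bit.
have ix : (address (rcons w i)).1 < size sixes by move: six; rewrite -index_mem.
rewrite /act_code -map_comp (nth_map [::] _ _ ix).
by rewrite [RHS]addbA.
Qed.

(** * Lists of codes *)

Lemma relabel_list_of_code (s : {perm 'I_8}) f c :
  (forall i, val ((s^-1)%g i) = f (val i)) -> compatible f ->
  relabel (list_of_code c) s = list_of_code (act_code f c).
Proof.
move=> sf cf; apply/ffunP => -[K i]; rewrite !ffunE /=.
have -> : #|(s @^-1: K)%SET| = #|K|.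
  by apply: on_card_preimset; exists (s^-1)%g => j _; rewrite (permK, permKV).
rewrite inE permKV; case: eqP => //= K5; case: (boolP (i \in K)) => //= iK.
rewrite chi_act ?word_five ?mem_word // sf; congr (chi c (rcons _ _)).
apply: (irr_sorted_eq ltn_trans ltnn); first exact: word_sorted.
  rewrite ltn_sorted_uniq_leq (sort_sorted leq_total) andbT sort_uniq.
  rewrite map_inj_in_uniq; first exact: (sorted_uniq ltn_trans ltnn (word_sorted K)).
  move=> m n mK nK; have m8 := allP (word_lt8 K) m mK; have n8 := allP (word_lt8 K) n nK.
  rewrite -[m]/(val (Ordinal m8)) -[n]/(val (Ordinal n8)) -!sf => /val_inj /perm_inj.
  by move/(congr1 val).
move=> n; rewrite mem_sort; apply/idP/mapP => [nK|[m mK ->]].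
  have n8 := allP (word_lt8 _) n nK; exists (val (s (Ordinal n8))).
    by move: nK; rewrite -[n]/(val (Ordinal n8)) !mem_word inE.
  by rewrite -sf permK.
have m8 := allP (word_lt8 K) m mK.
move: mK; rewrite -[m]/(val (Ordinal m8)) -sf !mem_word inE permKV.
by [].
Qed.

Lemma rotateE (k i : 'I_8) : val (((rotation k)^-1)%g i) = rotate_label k i.
Proof.
have -> : ((rotation k)^-1)%g i = (i - k)%R.
  by apply: (@perm_inj _ (rotation k)); rewrite permKV permE subrK.
by rewrite /rotate_label /= modnDmr.
Qed.

Lemma reflectE (k i : 'I_8) : val (((reflection k)^-1)%g i) = reflect_label k i.
Proof.
have -> : ((reflection k)^-1)%g i = (k - i)%R.
  by apply: (@perm_inj _ (reflection k)); rewrite permKV permE subKr.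
by rewrite /reflect_label /= modnDmr.
Qed.

Lemma relabel_rotation c (k : 'I_8) :
  relabel (list_of_code c) (rotation k) = list_of_code (act_code (rotate_label k) c).
Proof.
apply: relabel_list_of_code; first exact: rotateE.
by have /andP[] := allP dihedral_compatible k (etrans (mem_labels k) (ltn_ord k)).
Qed.

Lemma relabel_reflection c (k : 'I_8) :
  relabel (list_of_code c) (reflection k) = list_of_code (act_code (reflect_label k) c).
Proof.
apply: relabel_list_of_code; first exact: reflectE.
by have /andP[] := allP dihedral_compatible k (etrans (mem_labels k) (ltn_ord k)).
Qed.

Lemma succ8 (i : 'I_8) : val (i + 1)%R = (i + 1) %% 8.
Proof. by []. Qed.

Lemma octuple_list_of_code c (i : 'I_8) : octuple (list_of_code c) i = nth 0%R (oct c) i.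
Proof.
rewrite ffunE /oct (nth_map [::]) ?size_map ?size_iota // (nth_map 0) ?size_iota //.
rewrite nth_iota // add0n.
pose P w := [&& val i \notin w, val (i + 1)%R \notin w &
  chi c (rcons w (val i)) != chi c (rcons w (val (i + 1)%R))].
have sepE : separating (list_of_code c) i (i + 1)%R =
    [set K : {set 'I_8} | (#|K| == 5) && P (word K)]%SET.
  apply/setP => K; rewrite !inE; case: eqP => //= K5; rewrite /P !mem_word.
  by case iK: (i \in K); case jK: ((i + 1)%R \in K) => //=; rewrite !list_of_codeE ?iK ?jK.
rewrite /oct_entry /sep_table -succ8 -map_comp.
set F := _ \o _; set T := [seq K <- fives | _].
have -> : [seq ab <- [seq F K | K <- T] | ab.1 != ab.2] = [seq F K | K <- fives & P K].
  rewrite filter_map -filter_predI; congr (map _ _); apply: eq_filter => w /=.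
  by rewrite andbC -andbA.
rewrite size_map size_filter all_map -card_words -sepE /distance.
suff -> : outermost (list_of_code c) i (i + 1)%R =
   all (preim F (fun ab => ~~ ab.1 && ab.2)) [seq K <- fives | P K] by [].
apply/forall_inP/allP => [H w|H K].
  rewrite mem_filter => /andP[Pw w5]; have W := wordK w5.
  have K5 : #|word_set w| = 5.
    by apply/eqP; rewrite -size_word W; move: w5; rewrite mem_sublists_labels => /and3P[].
  have := H (word_set w); rewrite sepE inE K5 W Pw => /(_ isT).
  by case/and3P: Pw => iw jw _; rewrite !list_of_codeE ?W // inE.
rewrite sepE inE => /andP[/eqP K5 PK].
have := H (word K); rewrite mem_filter PK word_five // => /(_ isT).
by case/and3P: PK; rewrite !mem_word => iK jK _; rewrite !list_of_codeE.
Qed.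

Lemma eqbitsP s t : eqbits s t -> s = t.
Proof. by elim: s t => [|b s IHs] [|b' t] //=; case: ifP => //; case: b b' => -[] // _ /IHs ->. Qed.

Lemma bits_inP c cs : bits_in c cs -> c \in cs.
Proof. by case/hasP => d dcs /eqbitsP ->. Qed.

Lemma codes_octs c : c \in codes -> (c, oct c) \in octs.
Proof. by move=> cc; apply: map_f. Qed.

Lemma oct_bounded c i : c \in codes -> (i < 8)%N -> (-6 <= nth 0 (oct c) i <= 6)%R.
Proof.
move=> cc i8; have := allP octs_bounded _ (codes_octs cc).
by move/allP/(_ i (etrans (mem_labels i) i8)).
Qed.

Lemma oct_determines c d : c \in codes -> d \in codes -> oct c = oct d ->
  c = d \/ ambiguous (oct c) /\
    exists2 k, (k < 8)%N & d = act_code (reflect_label k) c.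
Proof.
move=> cc dd E.
have kc : ((c, oct c), Z_of_oct (oct c)) \in [seq (ct, Z_of_oct ct.2) | ct <- octs].
  exact: (map_f (fun ct => (ct, Z_of_oct ct.2)) (codes_octs cc)).
have kd : ((d, oct d), Z_of_oct (oct d)) \in [seq (ct, Z_of_oct ct.2) | ct <- octs].
  exact: (map_f (fun ct => (ct, Z_of_oct ct.2)) (codes_octs dd)).
have := allP (allP octs_determine _ kc) _ kd.
case: ifP => [_|/negP[]]; last by rewrite E; exact: Z.eqb_refl.
case: ifP => [/eqbitsP|_]; first by left.
case/andP=> amb /hasP[k kl /eqbitsP dE]; right; split; [exact: amb|exists k; last exact: dE].
by move: kl; rewrite mem_labels.
Qed.

Lemma oct_equivariant c k : c \in codes -> (k < 8)%N ->
  oct (act_code (rotate_label k) c) = rot_oct (8 - k) (oct c) /\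
  oct (act_code (reflect_label k) c) = refl_oct (k + 7) (oct c).
Proof.
move=> cc k8; have kl : k \in labels by rewrite mem_labels.
have /andP[/eqP E1 /eqP E2] := allP (allP octs_equivariant k kl) _ (codes_octs cc).
by split; [exact: E1|exact: E2].
Qed.

Lemma size_oct c : size (oct c) = 8.
Proof. by rewrite !size_map size_iota. Qed.

Lemma size_rot_oct k t : size (rot_oct k t) = 8.
Proof. by rewrite size_map size_iota. Qed.

Lemma size_refl_oct k t : size (refl_oct k t) = 8.
Proof. by rewrite size_map size_iota. Qed.

Lemma nth_rot_oct k t i : i < 8 -> nth 0%R (rot_oct k t) i = nth 0%R t ((i + k) %% 8).
Proof. by move=> i8; rewrite (nth_map 0) ?size_iota // nth_iota. Qed.

Lemma nth_refl_oct k t i : i < 8 ->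
  nth 0%R (refl_oct k t) i = (- nth 0%R t ((k + (8 - i)) %% 8))%R.
Proof. by move=> i8; rewrite (nth_map 0) ?size_iota // nth_iota. Qed.

Lemma reps_sum m c : c \in reps m -> absz (oct_sum (oct c)) = m.
Proof. by rewrite /reps mem_filter => /andP[/eqP]. Qed.

(** * The sign constraints *)

Local Open Scope ring_scope.

Section Signs.
Variable R : realDomainType.
Variable p : nat -> R * R * R.

Lemma hexad_at_swap u i j v : size (u ++ i :: j :: v) = 6%N ->
  hexad_at p (u ++ i :: j :: v) = - hexad_at p (u ++ j :: i :: v).
Proof.
case: u => [|a [|b [|c [|d [|e u]]]]].
- by move: v => [|k [|l [|m [|n [|o v]]]]] //= _; rewrite /hexad_at /= hexadC12.
- by move: v => [|k [|l [|m [|n v]]]] //= _; rewrite /hexad_at /= hexadC23.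
- by move: v => [|k [|l [|m v]]] //= _; rewrite /hexad_at /= hexadC34.
- by move: v => [|k [|l v]] //= _; rewrite /hexad_at /= hexadC45.
- by move: v => [|k v] //= _; rewrite /hexad_at /= hexadC56.
- by rewrite !size_cat /=; lia.
Qed.

Lemma bracket_at_swap u i j v : size (u ++ i :: j :: v) = 3%N ->
  bracket_at p (u ++ i :: j :: v) = - bracket_at p (u ++ j :: i :: v).
Proof.
case: u => [|a [|b u]].
- by move: v => [|k [|l v]] //= _; rewrite /bracket_at /= bracketC12.
- by move: v => [|k v] //= _; rewrite /bracket_at /= bracketC23.
- by rewrite !size_cat /=; lia.
Qed.

Definition labelling k (w : seq nat) := [&& uniq w, all (fun n => (n < 8)%N) w & size w == k].

Lemma labelling_sort k w : labelling k w -> sort leq w \in sublists k labels.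
Proof.
case/and3P=> uw lw zw; rewrite mem_sublists_labels size_sort zw all_sort lw andbT.
by rewrite ltn_sorted_uniq_leq sort_uniq uw (sort_sorted leq_total).
Qed.

Hypothesis positive : forall w, w \in sublists 3 labels -> 0 < bracket_at p w.
Hypothesis generic : forall w, w \in sixes -> hexad_at p w != 0.

Lemma bracket_sign w : labelling 3 w -> (bracket_at p w < 0) = odd_inv w.
Proof.
move=> w3; have [_ _ /eqP zw] := and3P w3.
rewrite (alternating_sort bracket_at_swap zw).
have := positive (labelling_sort w3); case: (odd_inv w) => pos.
  by rewrite expr1 mulN1r oppr_lt0.
by rewrite expr0 mul1r ltNge ltW.
Qed.

Lemma bracket_neq0 w : labelling 3 w -> bracket_at p w != 0.
Proof.
move=> w3; have [_ _ /eqP zw] := and3P w3.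
rewrite (alternating_sort bracket_at_swap zw).
by rewrite mulf_neq0 ?signr_eq0 // lt0r_neq0 // positive // labelling_sort.
Qed.

Lemma hexad_sign w : labelling 6 w -> (hexad_at p w < 0) = chi (code_at p) w.
Proof.
move=> w6; have [_ _ /eqP zw] := and3P w6.
have six := labelling_sort w6; have nz := generic six.
rewrite (alternating_sort hexad_at_swap zw).
have -> : chi (code_at p) w = (hexad_at p (sort leq w) < 0) (+) odd_inv w.
  have ix : ((address w).1 < size sixes)%N by move: six; rewrite -index_mem.
  rewrite /chi /read_bit /code_at (nth_map [::] _ _ ix).
  by rewrite /address nth_index.
case: (odd_inv w); last by rewrite expr0 mul1r addbF.
by rewrite expr1 mulN1r oppr_lt0 addbT lt_neqAle eq_sym nz -leNgt.
Qed.

Lemma hexad_neq0 w : labelling 6 w -> hexad_at p w != 0.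
Proof.
move=> w6; have [_ _ /eqP zw] := and3P w6.
rewrite (alternating_sort hexad_at_swap zw).
by rewrite mulf_neq0 ?signr_eq0 // generic // labelling_sort.
Qed.
End Signs.

(** A constraint of depth n reads only the first n + 1 bits. *)
Lemma search_sound c n : all (satisfies c) constraints -> (n <= size c)%N ->
  take n c \in search n.
Proof.
move=> cP; elim: n => [|n IHn] nc; first by rewrite take0 inE.
rewrite mem_filter; apply/andP; split; last first.
  rewrite (take_nth false nc); apply: allpairs_f; first exact: IHn (ltnW nc).
  by case: (nth false c n); rewrite !inE.
apply/allP => q; rewrite mem_filter => /andP[/eqP qn /(allP cP)].
have bound (s : seq nat) m : m \in s -> (m <= foldr maxn 0%N s)%N.
  elim: s => //= k s IHs; rewrite inE => /orP[/eqP ->|/IHs]; first exact: leq_maxl.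
  by move/leq_trans; apply; exact: leq_maxr.
have agree (t : term) : (forall m, m \in t.1 -> (m <= n)%N) ->
    eval_term (take n.+1 c) t = eval_term c t.
  move=> tn; rewrite /eval_term; congr (foldr _ _ _); apply/eq_in_map => m /tn mn.
  by rewrite nth_take.
move: qn; case: q => [[x y] z]; rewrite /depth /satisfies => qn.
by rewrite !agree // => m mt; rewrite -qn bound // !mem_cat mt ?orbT.
Qed.

Definition gp_words (t : seq nat) : seq (seq nat) :=
  let i := nth 0%N (remaining t) in
  [:: t ++ [:: i 0%N; i 1%N]; t ++ [:: i 2%N; i 3%N]; t ++ [:: i 0%N; i 2%N];
      t ++ [:: i 1%N; i 3%N]; t ++ [:: i 0%N; i 3%N]; t ++ [:: i 1%N; i 2%N]].

Lemma gp_words_labelling : all (fun t => all (labelling 6) (gp_words t)) (sublists 4 labels).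
Proof. by vm_compute. Qed.

Lemma pencil_words_labelling : all (fun t => all (fun s => all (fun u =>
    let i := nth 0%N u in let a := nth 0%N s in
    all (labelling 6) [:: s ++ [:: i 1%N; i 2%N]; s ++ [:: i 0%N; i 2%N]; s ++ [:: i 0%N; i 1%N]] &&
    all (fun m => labelling 3 [:: a 0%N; a 1%N; i m] && labelling 3 [:: a 2%N; a 3%N; i m])
        [:: 0%N; 1%N; 2%N])
  (sublists 3 (remaining t))) (pairings t)) (sublists 4 labels).
Proof. by vm_compute. Qed.

Section Constraints.
Variable R : realDomainType.
Variable p : nat -> R * R * R.
Hypothesis positive : forall w, w \in sublists 3 labels -> 0 < bracket_at p w.
Hypothesis generic : forall w, w \in sixes -> hexad_at p w != 0.
Let c := code_at p.

Lemma mulr_lt0_addb (x y : R) : x != 0 -> y != 0 -> (x * y < 0) = (x < 0) (+) (y < 0).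
Proof.
rewrite neq_lt => /orP[] x0 y0; first by rewrite nmulr_rlt0 // x0 lt_def y0 leNgt.
by rewrite pmulr_rlt0 // (ltNge x) (ltW x0).
Qed.

Lemma eval_term1 w b : labelling 6 w ->
  eval_term c (mkterm [:: w] b) = (hexad_at p w < 0) (+) b.
Proof. by move=> w6; rewrite (hexad_sign generic w6) /chi /read_bit -addbA. Qed.

Lemma eval_term2 v w b : labelling 6 v -> labelling 6 w ->
  eval_term c (mkterm [:: v; w] b) = (hexad_at p v * hexad_at p w < 0) (+) b.
Proof.
move=> v6 w6; rewrite mulr_lt0_addb ?(hexad_neq0 generic) //.
rewrite !(hexad_sign generic) // /chi /read_bit -!addbA.
by rewrite [in RHS](addbCA (address v).2).
Qed.

Lemma three_terms (x y z : R) : x != 0 -> y != 0 -> z != 0 -> x - y + z = 0 ->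
  ~~ (((x < 0) == ~~ (y < 0)) && (~~ (y < 0) == (z < 0))).
Proof.
move=> x0 y0 z0 E; apply/negP => /andP[/eqP xy /eqP yz].
have [xn|xp] := boolP (x < 0); rewrite ?xn ?(negPf xp) in xy; rewrite -xy in yz.
  have yp : 0 < y by rewrite lt_neqAle eq_sym y0 leNgt -xy.
  have zn : z < 0 by rewrite -yz.
  lra.
have yn : y < 0 by rewrite -[_ < _]negbK -xy.
have zp : 0 < z by rewrite lt_neqAle eq_sym z0 leNgt -yz.
have xp' : 0 < x by rewrite lt_neqAle eq_sym x0 leNgt.
lra.
Qed.

Lemma code_satisfies : all (satisfies c) constraints.
Proof.
rewrite all_cat; apply/andP; split; apply/allP => q.
  move=> /mapP[t t4 ->]; rewrite /satisfies.
  have := allP gp_words_labelling t t4; rewrite /gp_words.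
  set i := nth 0%N (remaining t) => /and5P[L1 L2 L3 L4 /and3P[L5 L6 _]].
  rewrite !eval_term2 // !addbF addbT.
  apply: three_terms; rewrite ?mulf_neq0 ?(hexad_neq0 generic) //.
  move: t4; rewrite mem_sublists_labels => /and3P[_ _]; case: (t) => [|? [|? [|? [|? [|? ?]]]]] // _.
  exact: hexad_gp.
move=> /flatten_mapP[t t4 /allpairsPdep[s [u [st ut ->]]]].
have := allP (allP (allP pencil_words_labelling t t4) s st) u ut.
rewrite /satisfies /pencil_constraint; set i := nth 0%N u.
case/andP=> /and4P[L1 L2 L3 _] /and4P[/andP[A0 C0] /andP[A1 C1] /andP[A2 C2] _].
have sg m (l := [:: nth 0%N s 0; nth 0%N s 1; i m]) (l' := [:: nth 0%N s 2; nth 0%N s 3; i m]) :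
    labelling 3 l -> labelling 3 l' -> forall w, labelling 6 w ->
    (bracket_at p l * bracket_at p l' * hexad_at p w < 0) =
    (hexad_at p w < 0) (+) (odd_inv l (+) odd_inv l').
  move=> A C w w6; rewrite !mulr_lt0_addb ?mulf_neq0 ?(bracket_neq0 positive) ?(hexad_neq0 generic) //.
  by rewrite !(bracket_sign positive) // addbC.
rewrite !eval_term1 // addbN -!sg //.
apply: three_terms; rewrite ?mulf_neq0 ?(bracket_neq0 positive) ?(hexad_neq0 generic) //.
have /eqP zs : size s == 4%N by have /and3P[_ _] := L1; rewrite size_cat addn2.
by case: (s) zs => [|? [|? [|? [|? [|? ?]]]]] // _; exact: hexad_pencil.
Qed.

Lemma code_in_codes : c \in codes.
Proof.
have z : size c = size sixes by rewrite size_map.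
have := @search_sound c 28 code_satisfies; rewrite take_oversize ?z; last by vm_compute.
by apply; vm_compute.
Qed.
End Constraints.

(** * Realized lists have codes *)

Section ListOf.
Variable R : realType.
Notation br u v w := (bracket (coords u) (coords v) (coords w)).

Variables (x : 'I_8 -> RP2 R) (a : 'I_8 -> 'rV[R]_3) (s : 'I_8 -> R).
Hypothesis s_neq0 : forall i, s i != 0.
Hypothesis hcoord_x : forall i, hcoord (x i) = s i *: a i.
Hypothesis a_pos : forall i j k : 'I_8, (i < j < k)%N -> 0 < br (a i) (a j) (a k).

Let p n := coords (a (inord n)).

Lemma positive_at w : w \in sublists 3 labels -> 0 < bracket_at p w.
Proof.
rewrite mem_sublists_labels => /and3P[+ + /eqP].
case: w => [|i [|j [|k [|? ?]]]] //= /andP[ij /andP[jk _]] /and4P[i8 j8 k8 _] _.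
by apply: a_pos; rewrite !inordK // ij.
Qed.

Lemma five_labels (K : {set 'I_8}) : #|K| = 5%N -> exists k1 k2 k3 k4 k5 : 'I_8,
  [/\ word K = [:: val k1; val k2; val k3; val k4; val k5],
      K = [set k in [:: k1; k2; k3; k4; k5]]%SET &
      0 < prod10 (a k1) (a k2) (a k3) (a k4) (a k5)].
Proof.
move=> K5; have := word_sorted K; have := word_lt8 K; have := size_word K; rewrite K5.
case E: (word K) => [|n1 [|n2 [|n3 [|n4 [|n5 [|? ?]]]]]] //= _.
case/and5P=> l1 l2 l3 l4 /andP[l5 _] /and5P[l12 l23 l34 l45 _].
exists (Ordinal l1), (Ordinal l2), (Ordinal l3), (Ordinal l4), (Ordinal l5); split=> //.
  by apply/setP => k; rewrite -mem_word E !inE.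
by rewrite /prod10 !mulr_gt0 // a_pos //=; lia.
Qed.

Lemma conic_through_six w : w \in sixes ->
  hexad_at p w = 0 <-> exists C, conic_through x (word_set w) C.
Proof.
move=> w6; have W := wordK w6; move: (w6); rewrite mem_sublists_labels.
case: w w6 W => [|n1 [|n2 [|n3 [|n4 [|n5 [|n6 [|? ?]]]]]]] w6 W; rewrite ?andbF //.
case/and3P=> /= /and5P[l12 l23 l34 l45 /andP[l56 _]].
case/and5P=> l1 l2 l3 l4 /and3P[l5 l6 _] _.
pose k1 := Ordinal l1; pose k2 := Ordinal l2; pose k3 := Ordinal l3.
pose k4 := Ordinal l4; pose k5 := Ordinal l5; pose k6 := Ordinal l6.
have P0 : prod10 (a k1) (a k2) (a k3) (a k4) (a k5) != 0.
  by rewrite lt0r_neq0 // /prod10 !mulr_gt0 // a_pos //=; lia.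
have -> : hexad_at p [:: n1; n2; n3; n4; n5; n6] = hexad (coords (a k1)) (coords (a k2))
   (coords (a k3)) (coords (a k4)) (coords (a k5)) (coords (a k6)).
  have I n (l : (n < 8)%N) : inord n = Ordinal l by apply: val_inj; rewrite /= inordK.
  by rewrite /hexad_at /p /= (I _ l1) (I _ l2) (I _ l3) (I _ l4) (I _ l5) (I _ l6).
rewrite -(conic_through_sixth s_neq0 hcoord_x P0); split=> [[C [Cc CK] C6]|[C [Cc CK]]].
  exists C; split=> // k; rewrite !inE => kw.
  case: (eqVneq k k6) => [->|k6'] //; apply: CK; move: k6' kw.
  rewrite !inE -!(inj_eq val_inj) /= => /negPf ->; by rewrite orbF.
exists C; last by apply: CK; rewrite !inE eqxx ?orbT.
split=> // k; rewrite !inE -!(inj_eq val_inj) /= => kw; apply: CK.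
by rewrite !inE; case/or4P: kw => [| | |/orP[|]] ->; rewrite ?orbT.
Qed.

Lemma genericP : generic x <-> forall w, w \in sixes -> hexad_at p w != 0.
Proof.
split=> [gen w w6|nz K K6 CK].
  apply/eqP => /(conic_through_six w6); apply: gen.
  by rewrite -size_word (wordK w6); move: w6; rewrite mem_sublists_labels => /and3P[_ _ /eqP].
have w6 : word K \in sixes by rewrite mem_sublists_labels word_sorted word_lt8 size_word K6.
by move/eqP: (nz _ w6); apply; apply/(conic_through_six w6); rewrite word_setK.
Qed.

(** The ten brackets of five sorted labels are positive, so that by [inside_conic5] the sixth
    point is inside exactly when the hexad is negative. *)
Lemma list_of_decode : generic x -> list_of x = list_of_code (code_at p).
Proof.
move=> /genericP nz; apply/ffunP => -[K i]; rewrite !ffunE /=.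
case: eqP => //= K5; case: (boolP (i \in K)) => //= iK.
have L6 : labelling 6 (rcons (word K) i).
  rewrite /labelling rcons_uniq mem_word iK (sorted_uniq ltn_trans ltnn (word_sorted K)).
  by rewrite all_rcons ltn_ord word_lt8 size_rcons size_word K5.
rewrite -(hexad_sign nz L6).
have [k1 [k2 [k3 [k4 [k5 [Kw KE P0]]]]]] := five_labels K5.
have P0' := lt0r_neq0 P0.
have -> : hexad_at p (rcons (word K) i) = hexad (coords (a k1)) (coords (a k2))
   (coords (a k3)) (coords (a k4)) (coords (a k5)) (coords (a i)).
  by rewrite Kw /hexad_at /p /= !inord_val.
have I5 := inside_conic5 s_neq0 hcoord_x P0' i; rewrite -KE pmulr_llt0 // in I5.
by apply/asboolP/idP => /I5.
Qed.
End ListOf.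

Lemma realized_decode (R : realType) (L : eight_list) : L \in realized_lists R ->
  exists2 c, c \in codes & L = list_of_code c.
Proof.
rewrite inE => /asboolP[x [/convex_position_frame[a [s [s0 hx pos]]] gen ->]].
exists (code_at (fun n => coords (a (inord n)))); last exact: list_of_decode.
apply: code_in_codes; first exact: positive_at.
exact/(genericP s0 hx pos).
Qed.

(** * Every code is realized *)

Section Realization.
Variable R : realType.
Notation br u v w := (bracket (coords u) (coords v) (coords w)).

Lemma positive_strictly_convex (a : 'I_8 -> 'rV[R]_3) :
  (forall i j k : 'I_8, (i < j < k)%N -> 0 < br (a i) (a j) (a k)) ->
  strictly_convex_octagon a.
Proof.
move=> pos i j k ji ki; have edge m : m \notin [:: i; i + 1] -> 0 < br (a i) (a (i + 1)) (a m).
  have -> : (m \notin [:: i; i + 1]) = (m != i :> nat) && (m != (i + 1)%N %% 8 :> nat)%N.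
    by rewrite !inE negb_or -!(inj_eq val_inj).
  move=> /andP[mi mi1]; have m8 := ltn_ord m; have i8 := ltn_ord i.
  have i1 : nat_of_ord (i + 1) = ((i + 1)%N %% 8)%N by [].
  case: (eqVneq (nat_of_ord i) 7%N) => i7.
    by rewrite -bracket_cycle; apply: pos; rewrite i1; rewrite i7 in mi mi1 *; lia.
  have {}i1 : nat_of_ord (i + 1) = i.+1 by rewrite i1 addn1 modn_small //; lia.
  case: (ltngtP m i) mi => // mi' _.
    by rewrite -bracket_cycle -bracket_cycle; apply: pos; rewrite mi' i1 ltnSn.
  by apply: pos; rewrite i1; move: mi1; rewrite addn1 modn_small; lia.
by rewrite /same_side !orientE mulr_gt0 ?edge.
Qed.

Let h (z : Z) : R := (int_of_Z z)%:~R.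

Lemma h_lt0 z : (h z < 0) = (z < 0).
Proof. by rewrite /h ltrz0 -[z in RHS]int_of_ZK ssrZ.Instances.Z_of_intE ltrz0. Qed.
Lemma h_gt0 z : (0 < h z) = (0 < z).
Proof. by rewrite /h ltr0z -[z in RHS]int_of_ZK ssrZ.Instances.Z_of_intE ltr0z. Qed.
Lemma h_eq0 z : (h z == 0) = (z == 0).
Proof. by rewrite /h intr_eq0 -[z in RHS]int_of_ZK ssrZ.Instances.Z_of_intE intr_eq0. Qed.

Let hp (t : Z * Z * Z) := (h t.1.1, h t.1.2, h t.2).

Lemma h_bracket t u v : bracket (hp t) (hp u) (hp v) = h (bracket t u v).
Proof. exact: (bracket_rmorph [the {rmorphism Z -> R} of intr \o int_of_Z]). Qed.

Lemma h_hexad t u v w x y :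
  hexad (hp t) (hp u) (hp v) (hp w) (hp x) (hp y) = h (hexad t u v w x y).
Proof. by rewrite /hexad !h_bracket /h !(rmorphB, rmorphM). Qed.

Variable P : seq (int * int).
Hypothesis P_convex : convexZ (config_point P).
Hypothesis P_generic : genericZ (config_point P).

Let a (i : 'I_8) : 'rV[R]_3 :=
  let t := hp (config_point P i) in \row_j [:: t.1.1; t.1.2; t.2]`_j.

Let coords_a i : coords (a i) = hp (config_point P i).
Proof. by rewrite /coords !mxE; case: (hp _) => [[? ?] ?]. Qed.

Let a_third i : a i 0 2%:R = 1.
Proof.
rewrite mxE /= /hp /config_point; case: (nth _ _ _) => u v.
exact: (rmorph1 [the {rmorphism Z -> R} of intr \o int_of_Z]).
Qed.

Let a_neq0 i : a i != 0.
Proof. by apply: contraTneq (oner_neq0 R) => a0; rewrite -(a_third i) a0 mxE eqxx. Qed.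

Let a_pos (i j k : 'I_8) : (i < j < k)%N -> 0 < br (a i) (a j) (a k).
Proof.
case/andP=> ij jk; rewrite !coords_a h_bracket h_gt0.
have := allP P_convex [:: val i; val j; val k]; rewrite mem_sublists_labels /= ij jk !ltn_ord.
by apply.
Qed.

Let x (i : 'I_8) : RP2 R := rp2_pt (a_neq0 i).
Let s (i : 'I_8) : R := hcoord (x i) 0 2%:R.

Let hcoord_x i : hcoord (x i) = s i *: a i.
Proof.
by rewrite /s; have [k _ ->] := hcoord_rp2_pt (a_neq0 i); rewrite mxE a_third mulr1.
Qed.

Let s_neq0 i : s i != 0.
Proof. by apply: contraNneq (hcoord_neq0 (x i)) => s0; rewrite hcoord_x s0 scale0r. Qed.

Let hexad_a w : w \in sixes ->
  hexad_at (fun n => coords (a (inord n))) w = h (hexad_at (config_point P) w).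
Proof.
rewrite mem_sublists_labels => /and3P[_ lw /eqP zw].
rewrite /hexad_at !coords_a !inordK ?h_hexad //; by apply: (allP lw); rewrite mem_nth ?zw.
Qed.

Lemma configuration_realized : list_of_code (code_at (config_point P)) \in realized_lists R.
Proof.
rewrite inE; apply/asboolP; exists x.
have gen : generic x.
  apply/(genericP s_neq0 hcoord_x a_pos) => w w6; rewrite hexad_a // h_eq0.
  exact: (allP P_generic).
split=> //.
  pose l : 'cV[R]_3 := \col_i (i == 2%:R)%:R.
  have lE i : (hcoord (x i) *m l) 0 0 = s i.
    by rewrite mx11_sum3 !mxE /= !mulr0 !add0r mulr1.
  exists l; first by apply/eqP => /matrixP/(_ 2%:R 0); rewrite !mxE eqxx => /eqP; rewrite oner_eq0.
  split=> [i|]; first by rewrite lE.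
  have -> : affine_pt l \o x = a.
    by apply/funext => i; rewrite /= /affine_pt lE hcoord_x scalerA mulVf // scale1r.
  exact: positive_strictly_convex.
rewrite (list_of_decode s_neq0 hcoord_x a_pos gen); congr list_of_code.
apply/eq_in_map => w w6; rewrite hexad_a // h_lt0 //.
Qed.
End Realization.

Lemma codes_realized (R : realType) c : c \in codes -> list_of_code c \in realized_lists R.
Proof.
move=> cc; have /bits_inP/mapP[P PI ->] := allP images_realize c cc.
have /andP[cvx gen] := allP images_convex P PI.
exact: configuration_realized.
Qed.

(** * Orbits and octuples *)

(* Unification would otherwise enumerate the codes. *)
Opaque rep_table codes octs oct act_code reps ambiguous rot_oct refl_oct.

Lemma reps_in m c : m \in levels -> c \in reps m -> c \in codes.
Proof.
move=> ml cm; apply: bits_inP; apply: (allP reps_codes).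
by apply/flatten_mapP; exists m.
Qed.

Lemma reps_cover_orbit c : c \in codes -> exists m k d,
  [/\ m \in levels, absz (oct_sum (oct c)) = m, ((k < 8)%N)%N, d \in reps m &
    c = act_code (rotate_label k) d \/ c = act_code (reflect_label k) d].
Proof.
move=> cc; have /hasP[ml mlT] := allP reps_cover _ (codes_octs cc).
case: ifP => [|_ F]; last (by case: (notF F)); move=> /eqP Em /bits_inP cm; have [m ml' E] := mapP mlT.
rewrite E in Em cm; have [d dm cd] := flatten_mapP cm.
have [k [k8 cE]] : exists k, (k < 8)%N /\
    (c = act_code (rotate_label k) d \/ c = act_code (reflect_label k) d).
  move: cd; rewrite mem_cat => /orP[] /mapP[k kl cE]; exists k;
    (split; first by move: kl; rewrite mem_labels); [left|right]; exact: cE.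
by exists m, k, d; split; [exact: ml'|exact: Em|exact: k8|exact: dm|exact: cE].
Qed.

Lemma rotationM j k : (rotation j * rotation k)%g = rotation (j + k).
Proof. by apply/permP => i; rewrite permM !permE addrA. Qed.
Lemma rotation_reflectionM j k : (rotation j * reflection k)%g = reflection (k - j).
Proof. by apply/permP => i; rewrite permM !permE; ring. Qed.
Lemma reflection_rotationM j k : (reflection j * rotation k)%g = reflection (j + k).
Proof. by apply/permP => i; rewrite permM !permE; ring. Qed.
Lemma reflectionM j k : (reflection j * reflection k)%g = rotation (k - j).
Proof. by apply/permP => i; rewrite permM !permE; ring. Qed.
Lemma rotation0 : rotation 0 = 1%g.
Proof. by apply/permP => i; rewrite permE perm1 addr0. Qed.

Lemma D8P s : s \in D8 -> exists k, s = rotation k \/ s = reflection k.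
Proof. by rewrite inE => /existsP[k /orP[] /eqP ->]; exists k; [left|right]. Qed.
Lemma rotation_D8 k : rotation k \in D8.
Proof. by rewrite inE; apply/existsP; exists k; rewrite eqxx. Qed.
Lemma reflection_D8 k : reflection k \in D8.
Proof. by rewrite inE; apply/existsP; exists k; rewrite eqxx orbT. Qed.

Lemma D8_group_set : group_set D8.
Proof.
apply/group_setP; split; first by rewrite -rotation0 rotation_D8.
move=> s t /D8P[j [] ->] /D8P[k [] ->].
- by rewrite rotationM rotation_D8.
- by rewrite rotation_reflectionM reflection_D8.
- by rewrite reflection_rotationM reflection_D8.
- by rewrite reflectionM rotation_D8.
Qed.

Lemma list_orbitP (L L' : eight_list) :
  list_orbit L = list_orbit L' <-> exists2 s, s \in D8 & L' = relabel L s.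
Proof.
rewrite /list_orbit; split=> [E|[s sD ->]].
  have : L' \in orbit relabel_action D8 L.
    by rewrite E; exact: (orbit_refl relabel_action (Group D8_group_set) L').
  by move=> /imsetP[s sD ->]; exists s.
apply/esym/(@orbit_eqP _ _ relabel_action (Group D8_group_set)).
by apply/imsetP; exists s.
Qed.

Lemma relabelM_list L s t : relabel (relabel L s) t = relabel L (s * t)%g.
Proof. by rewrite relabelM. Qed.

Lemma uniq_map_pairwise (T U : eqType) (f : T -> U) (r : rel T) (s : seq T) :
  {in s &, forall x y, f x = f y -> r x y} -> pairwise (fun x y => ~~ r x y) s ->
  uniq [seq f x | x <- s].
Proof.
elim: s => //= x s IHs fr /andP[xs ps]; rewrite IHs // ?andbT; last first.
  by move=> y z ys zs; apply: fr; rewrite inE ?ys ?zs orbT.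
apply/mapP => -[y ys E]; have := allP xs y ys.
by rewrite fr // inE ?eqxx // ys orbT.
Qed.

Lemma card_eq_seq (T : finType) (A : {set T}) (s : seq T) :
  A =i s -> uniq s -> #|A| = size s.
Proof. by move=> As /card_uniqP <-; exact: eq_card. Qed.

Section Realized.
Variable R : realType.
Implicit Types L : eight_list.

Lemma realizedP L : (L \in realized_lists R) <-> exists2 c, c \in codes & L = list_of_code c.
Proof.
split=> [/realized_decode//|[c cc ->]]; exact: codes_realized.
Qed.

(** The rotation by 1 and one reflection generate D8, so two checks on the codes suffice. *)
Lemma relabel_realized L s : L \in realized_lists R -> s \in D8 ->
  relabel L s \in realized_lists R.
Proof.
have gen M : M \in realized_lists R ->
    relabel M (rotation 1) \in realized_lists R /\
    relabel M (reflection 0) \in realized_lists R.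
  move=> /realizedP[c cc ->]; rewrite relabel_rotation relabel_reflection.
  have -> : nat_of_ord (1 : 'I_8) = 1%N by []. have -> : nat_of_ord (0 : 'I_8) = 0%N by [].
  have /andP[/bits_inP E1 /bits_inP E2] := allP codes_closed c cc.
  by split; [exact: codes_realized E1|exact: codes_realized E2].
have rot M (n : nat) : M \in realized_lists R -> relabel M (rotation n%:R) \in realized_lists R.
  move=> MR; elim: n => [|n IHn]; first by rewrite rotation0 relabel1.
  by rewrite mulrSr -rotationM -relabelM_list; case: (gen _ IHn).
move=> LR /D8P[k [] ->]; rewrite -(natr_Zp k); first exact: rot.
by rewrite -[_%:R]add0r -reflection_rotationM -relabelM_list; apply: rot; case: (gen _ LR).
Qed.

Lemma octuple_rotation L k i : L \in realized_lists R ->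
  octuple (relabel L (rotation k)) i = octuple L (i - k).
Proof.
move=> /realizedP[c cc ->]; rewrite relabel_rotation !octuple_list_of_code.
have [-> _] := oct_equivariant cc (ltn_ord k).
rewrite (nth_rot_oct _ _ (ltn_ord i)).
by have -> : nat_of_ord (i - k) = ((i + (8 - k)) %% 8)%N by rewrite /= modnDmr.
Qed.

Lemma octuple_reflection L k i : L \in realized_lists R ->
  octuple (relabel L (reflection k)) i = - octuple L (k - 1 - i).
Proof.
move=> /realizedP[c cc ->]; rewrite relabel_reflection !octuple_list_of_code.
have [_ ->] := oct_equivariant cc (ltn_ord k).
rewrite (nth_refl_oct _ _ (ltn_ord i)).
by have -> : nat_of_ord (k - 1 - i) = ((k + 7 + (8 - i)) %% 8)%N by rewrite /= modnDm.
Qed.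

Lemma octuple_equiv_relabel L s : L \in realized_lists R -> s \in D8 ->
  octuple_equiv (octuple L) (octuple (relabel L s)).
Proof.
move=> LR /D8P[k [] ->]; [exists (- k); left|exists (k - 1); right] => i.
  exact: octuple_rotation.
exact: octuple_reflection.
Qed.

Lemma sub_ordE (k i : 'I_8) : nat_of_ord (k - i) = ((k + (8 - i)) %% 8)%N.
Proof. by rewrite /= modnDmr. Qed.

Lemma oct_equiv_octuple c v : oct_equiv (oct c) v ->
  octuple_equiv (octuple (list_of_code c)) (octuple_of_seq v).
Proof.
case/hasP => k; rewrite mem_labels => k8 /orP[] /eqP ->;
  exists (Ordinal k8); [left|right] => i; rewrite octuple_list_of_code ffunE.
  by rewrite (nth_rot_oct _ _ (ltn_ord i)).
by rewrite (nth_refl_oct _ _ (ltn_ord i)) sub_ordE.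
Qed.

Lemma octuple_equiv_oct c d :
  octuple_equiv (octuple (list_of_code c)) (octuple (list_of_code d)) ->
  oct_equiv (oct c) (oct d).
Proof.
move=> [k kE]; apply/hasP; exists (val k); first exact: etrans (mem_labels k) (ltn_ord k).
apply/orP; case: kE => E; [left|right]; apply/eqP/(@eq_from_nth _ 0).
- by rewrite size_oct size_rot_oct.
- rewrite size_oct => n n8; have := E (Ordinal n8).
  by rewrite !octuple_list_of_code (nth_rot_oct _ _ n8).
- by rewrite size_oct size_refl_oct.
- rewrite size_oct => n n8; have := E (Ordinal n8).
  by rewrite !octuple_list_of_code (nth_refl_oct _ _ n8) sub_ordE.
Qed.

Lemma octuple_determines L L' : L \in realized_lists R -> L' \in realized_lists R ->
  octuple L = octuple L' ->
  L = L' \/ ambiguous_octuple (octuple L) /\ exists k : 'I_8, L' = relabel L (reflection k).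
Proof.
move=> /realizedP[c cc ->] /realizedP[d dd ->] E.
have Eo : oct c = oct d.
  apply: (@eq_from_nth _ 0); rewrite size_oct ?size_oct; first by [].
  move=> n n8; have /ffunP/(_ (Ordinal n8)) := E.
  by rewrite !octuple_list_of_code.
case: (oct_determines cc dd Eo) => [->|[amb [k k8 dE]]]; first by left.
right; split; last by exists (Ordinal k8); rewrite relabel_reflection dE.
by case/orP: amb => /oct_equiv_octuple H; [left|right].
Qed.

(** An element of D8 carries L to a list with the octuple of L'; if this list is not L', a
    further reflection carries it to L'. *)
Lemma octuple_equiv_orbit L L' : L \in realized_lists R -> L' \in realized_lists R ->
  octuple_equiv (octuple L) (octuple L') -> exists2 s, s \in D8 & L' = relabel L s.
Proof.
move=> LR LR' [k E].
have [s sD Es] : exists2 s, s \in D8 & octuple (relabel L s) = octuple L'.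
  case: E => E; [exists (rotation (- k))|exists (reflection (k + 1))];
    rewrite ?rotation_D8 ?reflection_D8 //; apply/ffunP => i; rewrite E.
    by rewrite octuple_rotation // opprK.
  by rewrite octuple_reflection // addrK.
have [<-|[_ [j ->]]] := octuple_determines (relabel_realized LR sD) LR' Es; first by exists s.
exists (s * reflection j)%g; last by rewrite relabelM_list.
by case/group_setP: D8_group_set => _; apply=> //; exact: reflection_D8.
Qed.

Lemma sigma_equiv (t u : {ffun 'I_8 -> int}) : octuple_equiv t u ->
  `|\sum_i u i| = `|\sum_i t i|.
Proof.
move=> [k [] E]; rewrite (eq_bigr _ (fun i _ => E i)).
  by rewrite [in RHS](reindex_inj (@addIr _ k)).
by rewrite sumrN normrN [in RHS](reindex_inj (@subrI _ k)).
Qed.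

Lemma sigma_list_of_code c : sigma (list_of_code c) = oct_sum (oct c).
Proof.
rewrite /sigma (eq_bigr _ (fun i _ => octuple_list_of_code c i)).
have -> : oct_sum (oct c) = \sum_(z <- oct c) z.
  rewrite /oct_sum; elim: (oct c) => [|z t IHt]; first by rewrite big_nil.
  by rewrite big_cons /= IHt.
by rewrite [in RHS](big_nth 0) size_oct big_mkord.
Qed.

Lemma rep_realized m c : m \in levels -> c \in reps m ->
  list_of_code c \in realized_lists R /\ `|sigma (list_of_code c)|%N = m.
Proof.
move=> ml cm; split; first exact: codes_realized (reps_in ml cm).
by rewrite sigma_list_of_code; exact: reps_sum cm.
Qed.

Lemma realized_rep L : L \in realized_lists R -> exists m d,
  [/\ m \in levels, `|sigma L|%N = m, d \in reps m & list_orbit L = list_orbit (list_of_code d)].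
Proof.
move=> /realizedP[c cc ->]; have [m [k [d [ml Em k8 dm cE]]]] := reps_cover_orbit cc.
exists m, d; split; [exact: ml|by rewrite sigma_list_of_code|exact: dm|].
apply/esym/list_orbitP; case: cE => ->.
  exists (rotation (Ordinal k8)); first exact: rotation_D8.
  exact/esym/(relabel_rotation d (Ordinal k8)).
exists (reflection (Ordinal k8)); first exact: reflection_D8.
exact/esym/(relabel_reflection d (Ordinal k8)).
Qed.

(** The representatives meet every orbit, and the inequivalence of their octuples shows that
    their orbits are distinct. *)
Lemma card_orbits_with m : m \in levels -> #|orbits_with R m| = size (reps m).
Proof.
move=> ml; pose orb c := list_orbit (list_of_code c).
have uniq_orb : uniq [seq orb c | c <- reps m].
  apply: uniq_map_pairwise (allP reps_inequiv m ml) => c d cm dm /list_orbitP[s sD E].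
  apply: octuple_equiv_oct; rewrite E; apply: octuple_equiv_relabel sD.
  by case: (rep_realized ml cm).
have same : orbits_with R m =i [seq orb c | c <- reps m].
  move=> O; apply/imsetP/mapP => [[L + ->]|[c cm ->]].
    rewrite inE => /andP[LR /eqP Lm]; have [m' [d [_ Em dm EO]]] := realized_rep LR.
    by exists d; [rewrite -Lm Em; exact: dm|exact: EO].
  have [cR cs] := rep_realized ml cm.
  by exists (list_of_code c); first by rewrite inE cR cs eqxx.
exact: etrans (card_eq_seq same uniq_orb) (size_map orb (reps m)).
Qed.

Lemma reps_nonempty m : m \in levels -> exists c, c \in reps m.
Proof.
move=> /(allP reps_inhabited); case: (reps m) => // c t _.
by exists c; exact: mem_head.
Qed.
End Realized.

Theorem proposition2 (R : realType) :
  (* (i), up to the two ambiguous classes of octuples *)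
  (forall L L' : eight_list,
     L \in realized_lists R -> L' \in realized_lists R ->
     octuple L = octuple L' ->
     L = L' \/
     ambiguous_octuple (octuple L) /\
     exists k : 'I_8, L' = relabel L (reflection k)) /\
  (* (ii) *)
  ((forall L : eight_list, L \in realized_lists R ->
      forall i : 'I_8, - 6 <= octuple L i <= 6) /\
   (forall L L' : eight_list,
      L \in realized_lists R -> L' \in realized_lists R ->
      (list_orbit L = list_orbit L' <->
       octuple_equiv (octuple L) (octuple L')))) /\
  (* (iii) *)
  ((forall (L : eight_list) (s : {perm 'I_8}),
      L \in realized_lists R -> s \in D8 ->
      `|sigma (relabel L s)| = `|sigma L|) /\
   (forall n : int,
      (exists2 L : eight_list, L \in realized_lists R & `|sigma L| = n) <->
      n \in [:: 0; 2; 4; 6; 8]) /\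
   [/\ #|orbits_with R 0| = 14%N, #|orbits_with R 2| = 12%N,
       #|orbits_with R 4| = 16%N, #|orbits_with R 6| = 4%N &
       #|orbits_with R 8| = 1%N]).
Proof.
split; first exact: octuple_determines.
split; [split|split; [|split]].
- move=> L /realizedP[c cc ->] i; rewrite octuple_list_of_code.
  exact: oct_bounded cc (ltn_ord i).
- move=> L L' LR LR'; split=> [/list_orbitP[s sD ->]|E].
    exact: octuple_equiv_relabel LR sD.
  by apply/list_orbitP; exact: octuple_equiv_orbit LR LR' E.
- move=> L s LR sD; exact: sigma_equiv (octuple_equiv_relabel LR sD).
- move=> n; split=> [[L LR <-]|nl].
    have [m [d [ml E _ _]]] := realized_rep LR.
    by rewrite -abszE E; move: ml; rewrite !inE => /or4P[| | |/orP[]] /eqP ->.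
  have [m ml ->] : exists2 m, m \in levels & n = m%:Z.
    by move: nl; rewrite !inE => /or4P[| | |/orP[]] /eqP ->;
      [exists 0%N|exists 2%N|exists 4%N|exists 6%N|exists 8%N].
  have [c cm] := reps_nonempty ml; have [cR cs] := rep_realized R ml cm.
  by exists (list_of_code c); [exact: cR|rewrite -abszE cs].
have /esym [-> -> -> -> ->] : [:: 14; 12; 16; 4; 1]%N = [seq #|orbits_with R m| | m <- levels].
  by rewrite -reps_size; apply/eq_in_map => m ml; rewrite card_orbits_with.
by split.
Qed.
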